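(* (a) If $G$ is connected, $\phi\in C^1(X,G)$, and $T_\phi$ is uniquely ergodic, then $\mathfrak g^{\mathrm{Ad}}=z(\mathfrak g)$ and the degree $P_\phi M_\phi$, which is $\mu_X$-almost everywhere equal to the constant $M_{\phi,\star}=P_{\mathrm{Ad}}\big(\int_Xd\mu_X(x)\,M_\phi(x)\big)$, belongs to the center of the Lie algebra $\mathfrak g$: $$M_{\phi,\star}=P_{\mathrm{Ad}}\left(\int_Xd\mu_X(x)\,M_\phi(x)\right)\in z(\mathfrak g).$$ Furthermore, if $\pi$ is a finite-dimensional irreducible unitary representation of $G$ and $(d\pi)_{e_G}:\mathfrak g\to\mathfrak g_\pi$ is surjective, then $(d\pi)_{e_G}(M_{\phi,\star})\in z(\mathfrak g_\pi)$. (b) If $G$ is a connected semisimple compact Lie group, then there does not exist a uniquely ergodic skew product $T_\phi$ with $\phi\in C^1(X,G)$ and nonzero degree (that is, with $P_\phi M_\phi\ne0$ on a set of positive $\mu_X$-measure).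
   Context: $X$ is a smooth compact second countable Hausdorff manifold with Borel probability measure $\mu_X$, and $\{F_t\}_{t\in\mathbb R}$ is a $C^1$ flow on $X$ preserving $\mu_X$, with continuous vector field $Y$; $\mathcal L_Yf(x)=\frac{d}{dt}|_{t=0}f(F_t(x))$. $G$ is a compact Lie group with normalised Haar measure $\mu_G$, identity $e_G$ and Lie algebra $\mathfrak g$, endowed with an $\mathrm{Ad}$-invariant scalar product $\langle\cdot,\cdot\rangle_{\mathfrak g}$, where $\mathrm{Ad}_gZ=gZg^{-1}$. $T_\phi:X\times G\to X\times G$, $T_\phi(x,g)=(F_1(x),g\phi(x))$; ''$T_\phi$ uniquely ergodic'' means that $\mu_X\otimes\mu_G$ is the only $T_\phi$-invariant Borel probability measure. $M_\phi:=\mathcal L_Y\phi\cdot\phi^{-1}:X\to\mathfrak g$ (right translation to $T_{e_G}G\simeq\mathfrak g$). $L^2(X,\mathfrak g)$ is the Hilbert space of measurable functions $X\to\mathfrak g$ with scalar product $\int_Xd\mu_X\langle f_1,f_2\rangle_{\mathfrak g}$; $W_\phi$ is the unitary operator in it given by $(W_\phi f)(x)=\mathrm{Ad}_{\phi(x)}f(F_1(x))$; $P_\phi$ is the orthogonal projection onto $\ker(1-W_\phi)$; $P_\phi M_\phi$ is called the degree of $\phi$. $\mathfrak g^{\mathrm{Ad}}:=\{Z\in\mathfrak g:\mathrm{Ad}_gZ=Z\ \forall g\in G\}$; $P_{\mathrm{Ad}}(Z):=\int_Gd\mu_G(g)\,\mathrm{Ad}_gZ$ for $Z\in\mathfrak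 g$; $z(\cdot)$ denotes the center of a Lie algebra; $\mathfrak g_\pi$ is the Lie algebra of $\pi(G)$ and $(d\pi)_{e_G}$ the differential of $\pi$ at $e_G$. *)

(* Defs.v *)
From HB Require Import structures.
From mathcomp Require Import all_boot all_order all_algebra.
From mathcomp Require Import sesquilinear spectral complex.
From mathcomp Require Import all_classical all_reals all_analysis.

Set Implicit Arguments.
Unset Strict Implicit.
Unset Printing Implicit Defensive.

Import Order.TTheory GRing.Theory Num.Theory.
Import numFieldNormedType.Exports.

Local Open Scope classical_set_scope.
Local Open Scope ring_scope.
Local Open Scope complex_scope.

Notation borel T := (g_sigma_algebraType (@open T)).

(* The two structures are tied together only by [compact_lie_group], which
   makes the group operations smooth, hence continuous. *)
#[short(type="ptopGroupType")]
HB.structure Definition PointedTopGroup := {G of PointedTopological G & Group G}.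

HB.instance Definition _ (X Y : ptopologicalType) := Pointed.on (X * Y)%type.

Section smooth_maps.
Context {R : realType}.

(* For V finite-dimensional and U open: f is of class C^k on U.  Existence and
   C^(k-1)-regularity of all the directional derivatives is equivalent to the
   same for the partial derivatives in a basis of V. *)
Fixpoint Ck (k : nat) {V W : normedModType R} (U : set V) (f : V -> W) : Prop :=
  if k is k'.+1 then
    forall v, (forall x, U x -> derivable f x v) /\ Ck k' U ('D_v f)
  else forall x, U x -> {for x, continuous f}.

(* A chart of T with values in E: only the values of [cmap] on [cdom], and of
   [cinv] on the image of [cdom], are meaningful. *)
Record chart (T : Type) (E : normedModType R) := Chart {
  cdom : set T;
  cmap : T -> E;
  cinv : E -> T }.

Definition chart_img {T E} (c : chart T E) : set E := cmap c @` cdom c.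

Definition is_chart {T : topologicalType} {E} (c : chart T E) : Prop :=
  [/\ open (cdom c) /\ open (chart_img c),
      forall x, cdom c x -> cinv c (cmap c x) = x,
      forall x, cdom c x -> {for x, continuous (cmap c)} &
      forall v, chart_img c v -> {for v, continuous (cinv c)}].

(* Atlases are not required to be maximal. *)
Definition smooth_atlas {T : topologicalType} {E} (A : set (chart T E)) : Prop :=
  [/\ forall c, A c -> is_chart c,
      forall x, exists2 c, A c & cdom c x &
      forall c d k, A c -> A d ->
        Ck k (cmap c @` (cdom c `&` cdom d)) (cmap d \o cinv c)].

Definition compact_manifold {T : topologicalType} {E}
    (A : set (chart T E)) : Prop :=
  [/\ smooth_atlas A, compact [set: T], hausdorff_space T & @second_countable T].

Definition Ck_map (k : nat) {M N : topologicalType} {E E'}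
    (A : set (chart M E)) (B : set (chart N E')) (f : M -> N) : Prop :=
  continuous f /\
  forall c d, A c -> B d ->
    Ck k (cmap c @` (cdom c `&` f @^-1` cdom d)) (cmap d \o f \o cinv c).

Definition prod_chart {M N : Type} {E E'} (c : chart M E) (d : chart N E') :
    chart (M * N) (E * E')%type :=
  Chart (cdom c `*` cdom d) (fun p => (cmap c p.1, cmap d p.2))
        (fun v => (cinv c v.1, cinv d v.2)).

Definition prod_atlas {M N : Type} {E E'}
    (A : set (chart M E)) (B : set (chart N E')) :
    set (chart (M * N) (E * E')%type) :=
  [set prod_chart c d | c in A & d in B].

Definition line_atlas : set (chart R R^o) := [set Chart setT id id].

Definition C1_flow {X : topologicalType} {E} (AX : set (chart X E))
    (F : R -> X -> X) : Prop :=
  [/\ F 0 = id, forall s t, F (s + t) = F s \o F t &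
      Ck_map 1 (prod_atlas line_atlas AX) AX (fun p : R * X => F p.1 p.2)].

End smooth_maps.

Section invariant_measures.
Context {R : realType}.

Definition preserves {T : ptopologicalType} (mu : set T -> \bar R)
    (f : T -> T) : Prop :=
  forall A : set (borel T), measurable A -> mu (f @^-1` A) = mu A.

Definition uniquely_ergodic {T : ptopologicalType} (mu : set T -> \bar R)
    (f : T -> T) : Prop :=
  preserves mu f /\
  forall nu : probability (borel T) R, preserves nu f ->
    forall A : set (borel T), measurable A -> nu A = mu A.

Definition haar {G : ptopGroupType} (mG : probability (borel G) R) : Prop :=
  forall g : G, preserves mG (fun h => g * h)%g.

Definition integral_rV {T : ptopologicalType} {n}
    (mu : probability (borel T) R) (f : T -> 'rV[R]_n) : 'rV[R]_n :=
  \row_j \int[mu]_x (f x 0 j).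

Definition L2 {T : ptopologicalType} {n} (mu : probability (borel T) R)
    (ip : {dot 'rV[R]_n for idfun}) : set (T -> 'rV[R]_n) :=
  [set f | measurable_fun [set: borel T] (f : borel T -> borel 'rV[R]_n) /\
           (\int[mu]_x (ip (f x) (f x))%:E < +oo)%E].

(* p is a representative of the orthogonal projection of the class of f in
   L^2(mu) onto the subspace of the classes of the elements of K; it is only
   determined up to a mu-negligible set. *)
Definition is_orth_proj {T : ptopologicalType} {n}
    (mu : probability (borel T) R) (ip : {dot 'rV[R]_n for idfun})
    (K : set (T -> 'rV[R]_n)) (f p : T -> 'rV[R]_n) : Prop :=
  [/\ L2 mu ip f, K p &
      forall h, K h -> \int[mu]_x ip (f x - p x) (h x) = 0].

End invariant_measures.

Section lie_algebras.
Context {R : realType}.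

Definition lie_center {V : zmodType} (br : V -> V -> V) (L : set V) : set V :=
  [set Z | L Z /\ forall W, L W -> br W Z = 0].

Context {V : vectType R} (br : V -> V -> V).

Definition lie_ideal (I : {vspace V}) : Prop :=
  forall W Z, Z \in I -> br W Z \in I.

(* By bilinearity of br, the brackets of basis vectors span [I, I]. *)
Definition derived (I : {vspace V}) : {vspace V} :=
  <<[seq br Z W | Z <- vbasis I, W <- vbasis I]>>%VS.

Definition lie_solvable (I : {vspace V}) : Prop :=
  exists k, iter k derived I = 0%VS.

Definition lie_semisimple : Prop :=
  forall I : {vspace V}, lie_ideal I -> lie_solvable I -> I = 0%VS.

End lie_algebras.

Section lie_groups.
Context {R : realType} {G : ptopGroupType} {n : nat}.

Definition compact_lie_group (AG : set (chart G 'rV[R]_n)) : Prop :=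
  [/\ compact_manifold AG,
      forall k, Ck_map k (prod_atlas AG AG) AG (fun p : G * G => p.1 * p.2)%g &
      forall k, Ck_map k AG AG (fun g => g^-1)%g].

(* The Lie algebra, i.e. the tangent space of G at the identity, is 'rV[R]_n:
   a tangent vector is given by its coordinates in a chart c at the identity,
   the velocity of a curve t |-> y t with y 0 = 1 being the derivative at 0 of
   t |-> cmap c (y t). *)
Context (c : chart G 'rV[R]_n).

Definition tangent_at1 {W : normedModType R} (f : G -> W) (Z : 'rV[R]_n) : W :=
  'D_Z (f \o cinv c) (cmap c 1%g).

(* the differential at 1 of h |-> g h g^-1 *)
Definition Ad (g : G) (Z : 'rV[R]_n) : 'rV[R]_n :=
  tangent_at1 (fun h => cmap c (g * h * g^-1)%g) Z.

(* ad = d(Ad)_1 *)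
Definition bracket (W Z : 'rV[R]_n) : 'rV[R]_n :=
  tangent_at1 (fun g => Ad g Z) W.

Definition Ad_invariant (ip : {dot 'rV[R]_n for idfun}) : Prop :=
  forall g Z W, ip (Ad g Z) (Ad g W) = ip Z W.

Definition Ad_fixed : set 'rV[R]_n := [set Z | forall g, Ad g Z = Z].

Definition P_Ad (mG : probability (borel G) R) (Z : 'rV[R]_n) : 'rV[R]_n :=
  integral_rV mG (fun g => Ad g Z).

End lie_groups.

Section representations.
Context {R : realType} {G : ptopGroupType} {n m : nat}.

Definition unitary_representation (rho : G -> 'M[R[i]]_m) : Prop :=
  [/\ forall g, rho g \is unitarymx,
      forall g h, rho (g * h)%g = rho g *m rho h &
      forall i j, continuous (fun g => complex.Re (rho g i j) : R) /\
                  continuous (fun g => complex.Im (rho g i j) : R)].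

Definition irreducible_representation (rho : G -> 'M[R[i]]_m) : Prop :=
  (0 < m)%N /\
  forall U : {vspace 'cV[R[i]]_m},
    (forall g v, v \in U -> rho g *m v \in U) -> U = 0%VS \/ U = fullv.

Definition drep (c : chart G 'rV[R]_n) (rho : G -> 'M[R[i]]_m)
    (Z : 'rV[R]_n) : 'M[R[i]]_m :=
  \matrix_(i, j) (tangent_at1 c (fun g => complex.Re (rho g i j) : R^o) Z
              +i* tangent_at1 c (fun g => complex.Im (rho g i j) : R^o) Z).

Definition mx_bracket (A B : 'M[R[i]]_m) : 'M[R[i]]_m := A *m B - B *m A.

(* The Lie algebra of a matrix Lie group H: the velocities at the identity of
   the curves in H. *)
Definition mx_lie_algebra (H : set 'M[R[i]]_m) : set 'M[R[i]]_m :=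
  [set V | exists y : R -> 'M[R[i]]_m,
    [/\ y 0 = 1%:M, \forall t \near (0 : R), H (y t) &
        forall i j,
          is_derive (0 : R) (1 : R)
            (fun t => complex.Re (y t i j) : R^o) (complex.Re (V i j)) /\
          is_derive (0 : R) (1 : R)
            (fun t => complex.Im (y t i j) : R^o) (complex.Im (V i j))]].

End representations.

Section cocycles.
Context {R : realType} {X : ptopologicalType} {G : ptopGroupType} {n : nat}.
Context (F : R -> X -> X) (c : chart G 'rV[R]_n) (phi : X -> G).

Definition skew_product (p : X * G) : X * G := (F 1 p.1, p.2 * phi p.1)%g.

(* The tangent vector (L_Y phi)(x) is the velocity at t = 0 of the curve
   phi (F_t x), so its right translate is the velocity of the translated
   curve. *)
Definition M_ (x : X) : 'rV[R]_n :=
  derive1 (fun t : R => cmap c (phi (F t x) * (phi x)^-1)%g) 0.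

Definition W_ (f : X -> 'rV[R]_n) (x : X) : 'rV[R]_n :=
  Ad c (phi x) (f (F 1 x)).

Context (mX : probability (borel X) R) (ip : {dot 'rV[R]_n for idfun}).

Definition ker_1subW : set (X -> 'rV[R]_n) :=
  [set f | L2 mX ip f /\ {ae mX, forall x, W_ f x = f x}].

Definition is_degree (p : X -> 'rV[R]_n) : Prop :=
  is_orth_proj mX ip ker_1subW M_ p.

Definition M_star (mG : probability (borel G) R) : 'rV[R]_n :=
  P_Ad c mG (integral_rV mX M_).

End cocycles.

(* Main.v *)
Require Import Defs.
From HB Require Import structures.
From mathcomp Require Import all_boot all_order all_algebra.
From mathcomp Require Import sesquilinear spectral complex.
From mathcomp Require Import all_classical all_reals all_analysis.
From mathcomp Require Import measurable_realfun lra.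

Set Implicit Arguments.
Unset Strict Implicit.
Unset Printing Implicit Defensive.

Import Order.TTheory GRing.Theory Num.Theory.
Import numFieldNormedType.Exports.

Local Open Scope classical_set_scope.
Local Open Scope ring_scope.

(** Let [f] be a square integrable function with [W_phi f = f].  The function
    [(x, g) |-> Ad_g f(x)] is then invariant under [T_phi].  Unique ergodicity
    gives every almost invariant set measure 0 or 1, since otherwise the
    conditional measure on it would be a second invariant probability measure
    ([uniquely_ergodic_01]); hence this function is almost everywhere constant
    ([invariant_ae_constant]).  Restricting to almost every fibre and using
    that Haar measure is left invariant, one finds that [f] is almost
    everywhere equal to a vector fixed by all the [Ad_g] ([ker_ae_constant]).
    So the kernel of [1 - W_phi] consists of the constants in the space of
    [Ad]-fixed vectors.  On that space the Haar average [P_Ad] is the orthogonal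
    projection ([P_Ad_fixed], [P_Ad_orthogonal]), and the degree is therefore
    the constant [P_Ad (\int M_phi)] ([degree_Mstar], [degree_unique]).  The
    field [M_phi] is square integrable because it is continuous
    ([M_continuous]).

    That the [Ad]-fixed vectors form the center of the Lie algebra is
    infinitesimal: by left translation, the derivative of [g |-> Ad_g Z] at [g]
    is the image by [Ad_g] of its derivative [W |-> [W, Z]] at the identity, so
    for central [Z] this map is locally constant, hence constant when [G] is
    connected ([Ad_fixed_center]).

    A continuous finite-dimensional representation is differentiable at the
    identity: its convolution with a C^1 bump function is differentiable, and
    equals the representation times an invertible matrix
    ([real_rep_differentiable]).  For an [Ad]-fixed [Z], differentiating
    [rho g * rho h = rho (g h g^-1) * rho g] at [h = 1] shows that [drho Z]
    commutes with all the [rho g] ([drep_comm]), hence with the velocity of any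
    curve in the image of [rho] ([drep_center]).

    Finally an [Ad]-fixed vector spans an abelian ideal, so that it vanishes
    when the Lie algebra is semisimple ([semisimple_Ad_fixed]); then so does the
    degree.

    The differentiability classes are given by iterated directional
    derivatives.  The mean value theorem turns continuous directional
    derivatives into a Frechet derivative ([C1_differentiable]), whence the
    chain rule and the stability of the classes under composition ([Ck_comp],
    [Ck_map_comp]). *)

(** * Directional derivatives and Frechet differentiability *)
Section directional_derivatives.
Context {R : realType}.

Lemma is_derive_lin {V W Z : normedModType R} (L : {linear W -> Z})
    (f : V -> W) (x v : V) :
  continuous L -> derivable f x v ->
  is_derive x v (L \o f) (L ('D_v f x)).
Proof.
move=> Lc df.
have LdE : (fun h : R => h^-1 *: ((L \o f \o shift x) (h *: v) - (L \o f) x)) =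
    L \o (fun h : R => h^-1 *: ((f \o shift x) (h *: v) - f x)).
  by apply/funext => h; rewrite [in RHS]/= linearZ_LR (linearB L).
have cvgLd : (fun h : R => h^-1 *: ((L \o f \o shift x) (h *: v) - (L \o f) x))
    @ 0^' --> L ('D_v f x).
  rewrite LdE; apply: cvg_comp; last exact: Lc.
  exact: df.
split; first by apply/cvg_ex; eexists; exact: cvgLd.
exact: cvg_lim cvgLd.
Qed.

Lemma is_deriveZ_dir {V W : normedModType R} (f : V -> W) (x v : V) (k : R) :
  derivable f x v -> is_derive x (k *: v) f (k *: 'D_v f x).
Proof.
move=> df; have [->|k0] := eqVneq k 0; first by rewrite !scale0r; exact: is_derive0.
have cvgk : (fun h : R => h^-1 *: ((f \o shift x) (h *: (k *: v)) - f x))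
    @ 0^' --> k *: 'D_v f x.
  rewrite (_ : (fun h : R => _) = (fun h : R => k *:
     (fun h : R => h^-1 *: ((f \o shift x) (h *: v) - f x)) (h * k))); last first.
    apply/funext => h /=; rewrite !scalerA invfM mulrCA.
    by rewrite mulfV // mulr1.
  apply: cvgZl_tmp; apply: (cvg_comp (fun h : R => h * k) _ _ df).
  move=> A; rewrite /= !nbhs_simpl /= => -[e /= e0 eA].
  exists (e / `|k|) => /=; first by rewrite divr_gt0 // normr_gt0.
  move=> h /= hk h0; apply: eA; last by rewrite mulf_neq0.
  move: hk; rewrite /ball /= !sub0r !normrN normrM.
  by rewrite ltr_pdivlMr // normr_gt0.
split; first by apply/cvg_ex; eexists; exact: cvgk.
exact: cvg_lim cvgk.
Qed.

Lemma is_derive_line {V W : normedModType R} (f : V -> W) (x h : V) (t : R) :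
  derivable f (x + t *: h) h ->
  is_derive t 1 (fun s : R => f (x + s *: h)) ('D_h f (x + t *: h)).
Proof.
move=> df.
have E : (fun k : R => k^-1 *: (((fun s : R => f (x + s *: h)) \o shift t) (k *: 1)
     - f (x + t *: h))) =
   (fun k : R => k^-1 *: ((f \o shift (x + t *: h)) (k *: h) - f (x + t *: h))).
  apply/funext => k /=; rewrite [_%:A]mulr1 scalerDl.
  by rewrite addrCA.
by split; rewrite /derivable /derive E.
Qed.

Lemma mean_value {V : normedModType R} (f : V -> R^o) (x h : V) :
  (forall t : R, 0 <= t <= 1 -> derivable f (x + t *: h) h) ->
  exists2 t : R, 0 <= t <= 1 & f (x + h) - f x = 'D_h f (x + t *: h).
Proof.
move=> df; have dline (t : R) : t \in `[0, 1]%R ->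
    is_derive t 1 (fun s : R => f (x + s *: h)) ('D_h f (x + t *: h)).
  by rewrite in_itv /= => t01; apply: is_derive_line; exact: df.
pose g : R -> R := fun s => f (x + s *: h).
pose dg : R -> R := fun t => 'D_h f (x + t *: h).
have gc : {within `[0, 1], continuous g}.
  by apply: derivable_within_continuous => t /dline [].
have dline' (t : R) : t \in `]0, 1[%R -> is_derive t 1 (g : R -> R^o) (dg t).
  by move=> t01; apply: dline; exact: subset_itv_oo_cc.
have [t t01 gE] := MVT_segment ler01 dline' gc.
exists t; first by move: t01; rewrite in_itv.
by move: gE; rewrite /g /dg subr0 mulr1 scale1r scale0r addr0.
Qed.

(** The difference quotient in the direction [v + w] is the sum of the one in
    the direction [v] at [x] and the one in the direction [w] at [x + h v]; by
    the mean value theorem the latter is a value of ['D_w f] near [x]. *)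
Lemma derive_dirD {V : normedModType R} (U : set V) (f : V -> R^o) (x v w : V) :
  open U -> U x -> (forall y u, U y -> derivable f y u) ->
  {for x, continuous ('D_w f)} ->
  'D_(v + w) f x = 'D_v f x + 'D_w f x.
Proof.
move=> oU Ux df Dwc.
have [e e0 eU] : exists2 e : R, 0 < e & ball x e `<=` U.
  by apply/nbhs_ballP; exact: open_nbhs_nbhs.
have cvg2 : (fun h : R => h^-1 *: (f (h *: (v + w) + x) - f (h *: v + x)))
    @ 0^' --> 'D_w f x.
  apply/cvgrPdist_le => /= eps eps0.
  have [d /= d0 dD] : exists2 d : R, 0 < d & ball x d `<=`
      [set y | `|'D_w f x - 'D_w f y| <= eps].
    by apply/nbhs_ballP; move/cvgrPdist_le: Dwc; apply.
  have bh (h : R) : `|h| < Num.min e d / (`|v| + `|w| + 1) ->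
     forall t : R, 0 <= t <= 1 -> `|h *: v + t *: (h *: w)| < Num.min e d.
    move=> hb t /andP[t0 t1].
    have nvw : 0 < `|v| + `|w| + 1 by rewrite ltr_wpDl.
    rewrite ltr_pdivlMr // in hb; apply: le_lt_trans hb.
    apply: le_trans (ler_normD _ _) _; rewrite !normrZ (ger0_norm t0).
    rewrite !mulrDr mulr1 -addrA lerD2l ler_wpDr //.
    by rewrite ler_piMl // mulr_ge0.
  (* below this bound the whole segment from x + h v to x + h v + h w is in
     both balls *)
  exists (Num.min e d / (`|v| + `|w| + 1)).
    by rewrite /= divr_gt0 ?lt_min ?e0 // ltr_wpDl.
  move=> h /=; rewrite sub0r normrN => /bh {}bh h0.
  have [|t t01] := @mean_value V f (h *: v + x) (h *: w).
    move=> t t01; apply: df; apply: eU; rewrite -ball_normE /= distrC addrAC addrK.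
    by apply: lt_le_trans (bh _ t01) _; rewrite ge_min lexx.
  have -> : h *: v + x + h *: w = h *: (v + w) + x by rewrite scalerDr addrAC.
  move=> ->; have /(is_deriveZ_dir h) [_ ->] : derivable f (h *: v + x + t *: (h *: w)) w.
    apply: df; apply: eU; rewrite -ball_normE /= distrC addrAC addrK.
    by apply: lt_le_trans (bh _ t01) _; rewrite ge_min lexx.
  rewrite scalerA mulVf // scale1r; apply: dD.
  rewrite -ball_normE /= distrC addrAC addrK.
  by apply: lt_le_trans (bh _ t01) _; rewrite ge_min lexx orbT.
apply: cvg_lim => //.
rewrite (_ : (fun h : R => _) = (fun h : R => h^-1 *: (f (h *: v + x) - f x)) +
  (fun h : R => h^-1 *: (f (h *: (v + w) + x) - f (h *: v + x)))); last first.
  apply/funext => h.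
  change (h^-1 *: (f (h *: (v + w) + x) - f x) = h^-1 *: (f (h *: v + x) - f x)
    + h^-1 *: (f (h *: (v + w) + x) - f (h *: v + x))).
  rewrite -scalerDr; congr (_ *: _).
  by rewrite [RHS]addrC subrKA.
by apply: cvgD => //; exact: df.
Qed.

End directional_derivatives.

(** Finite dimension, presented by vectors and continuous linear coordinates so
    that frames of row vectors, scalars and products are immediate. *)
Class framed {R : realType} (V : normedModType R) := Frame {
  fdim : nat;
  fvec : 'I_fdim -> V;
  fco : 'I_fdim -> {linear V -> R^o};
  fco_continuous : forall i, continuous (fco i);
  fcoE : forall v, v = \sum_i fco i v *: fvec i }.
Arguments fdim {R} V {framed}.

Section C1_differentiable.
Context {R : realType} {V : normedModType R} {fV : framed V}.

Lemma derive_fco (U : set V) (f : V -> R^o) (x u : V) :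
  open U -> U x -> Ck 1 U f ->
  'D_u f x = \sum_i fco i u * 'D_(fvec i) f x.
Proof.
move=> oU Ux C1f.
have df y w : U y -> derivable f y w by move=> Uy; exact: (C1f w).1.
have Dc w : {for x, continuous ('D_w f)} by apply: (C1f w).2.
rewrite {1}(fcoE u).
elim/big_rec2: _ => [|i y w _ <-]; first by rewrite derive0.
rewrite addrC (derive_dirD _ oU Ux) // addrC; congr (_ + _).
by have [_ ->] := is_deriveZ_dir (fco i u) (df x (fvec i) Ux).
Qed.

(** The remainder is controlled by the oscillation of the partial derivatives
    on the ball, so the estimate is uniform in any family of functions for which
    this oscillation is: this is what differentiation under the integral sign
    will use. *)
Lemma C1_taylor (f : V -> R^o) (x : V) (r eps : R) :
  Ck 1 (ball x r) f ->
  (forall i y, ball x r y -> `|'D_(fvec i) f y - 'D_(fvec i) f x| <= eps) ->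
  forall u, `|u| < r ->
    `|f (x + u) - f x - \sum_i fco i u * 'D_(fvec i) f x|
      <= eps * \sum_i `|fco i u|.
Proof.
move=> C1f osc u ur.
have xtu (t : R) : 0 <= t <= 1 -> ball x r (x + t *: u).
  move=> /andP[t0 t1]; rewrite -ball_normE /= opprD addrA subrr sub0r normrN.
  rewrite normrZ ger0_norm //; apply: le_lt_trans ur.
  by rewrite ler_piMl.
have [t t01|t t01 ->] := @mean_value _ V f x u.
  by apply: (C1f u).1; exact: xtu.
rewrite (derive_fco u (@ball_open _ _ x r) (xtu _ t01)) // -sumrB mulr_sumr.
apply: le_trans (ler_norm_sum _ _ _) _; apply: ler_sum => i _.
by rewrite -mulrBr normrM mulrC ler_wpM2r //; apply: osc; exact: xtu.
Qed.

Lemma fco_bound : exists2 k : R, 0 < k & forall u : V, \sum_i `|fco i u| <= k * `|u|.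
Proof.
have /choice[k kP] (i : 'I_(fdim V)) :
    exists k : R, 0 <= k /\ forall u, `|fco i u| <= k * `|u|.
  have [k k0 kP] := linear_lipschitz (@fco_continuous _ _ fV i).
  by exists k; split; [exact: ltW|].
exists (1 + \sum_i k i).
  by rewrite ltr_wpDr // sumr_ge0 // => i _; exact: (kP i).1.
move=> u; rewrite mulrDl mul1r mulr_suml ler_wpDl //.
by apply: ler_sum => i _; exact: (kP i).2.
Qed.

Definition partial_map (a : 'I_(fdim V) -> R) (u : V) : R^o :=
  \sum_i fco i u * a i.

Lemma partial_map_linear a : linear (partial_map a).
Proof.
move=> k u v; rewrite /partial_map scaler_sumr -big_split /=.
by apply: eq_bigr => i _; rewrite linearP mulrDl -mulrA.
Qed.
HB.instance Definition _ a := GRing.isLinear.Build R V R^o *:%R (partial_map a)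
  (partial_map_linear a).

Lemma partial_map_continuous a : continuous (partial_map a).
Proof.
rewrite /partial_map; apply: continuous_big => [|i _ x]; first exact: add_continuous.
by apply: cvgMr_tmp; exact: fco_continuous.
Qed.

Lemma differentiable_frechet (f : V -> R^o) (a : 'I_(fdim V) -> R) (x : V) :
  (forall eps : R, 0 < eps -> \forall u \near (0 : V),
    `|f (x + u) - f x - \sum_i fco i u * a i| <= eps * \sum_i `|fco i u|) ->
  differentiable f x.
Proof.
move=> fa; have [k k0 kP] := fco_bound.
have E : f \o shift x = cst (f x) + partial_map a +o_ 0 id.
  apply/eqaddoP => eps eps0.
  have := fa _ (divr_gt0 eps0 k0); apply: filterS => u /= ub.
  change (`|f (u + x) - (f x + partial_map a u)| <= eps * `|u|).
  rewrite opprD addrA [u + x]addrC.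
  apply: le_trans ub _; rewrite mulrAC ler_pdivrMr // -mulrA; apply: ler_wpM2l; first exact: ltW.
  by rewrite [leRHS]mulrC; exact: kP.
apply/diff_locallyP; rewrite (diff_unique (df := partial_map a) _ E) //;
  [split => //|]; exact: partial_map_continuous.
Qed.

Lemma C1_differentiable_real (U : set V) (f : V -> R^o) (x : V) :
  open U -> U x -> Ck 1 U f -> differentiable f x.
Proof.
move=> oU Ux C1f.
apply: (@differentiable_frechet f (fun i => 'D_(fvec i) f x)) => eps eps0.
have /nbhs_ballP[r /= r0 rP] : \forall y \near x,
    U y /\ forall i, `|'D_(fvec i) f y - 'D_(fvec i) f x| <= eps.
  near=> y; split; first by near: y; exact: open_nbhs_nbhs.
  near: y; apply: filter_forall => i.
  have /cvgrPdist_le /(_ _ eps0) := (C1f (fvec i)).2 x Ux.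
  by apply: filterS => y; rewrite distrC.
apply/nbhs_ballP; exists r => //= u; rewrite -ball_normE /= sub0r normrN => ur.
apply: (@C1_taylor _ _ r) => //.
  by move=> v; split => y /rP[Uy _]; [exact: (C1f v).1|exact: (C1f v).2].
by move=> i y /rP[].
Unshelve. all: by end_near. Qed.

End C1_differentiable.

(** * Calculus of the classes C^k *)
Section frames.
Context {R : realType}.

Definition rV_coord n (i : 'I_n) (v : 'rV[R]_n) : R^o := v 0 i.
Lemma rV_coord_linear n i : linear (@rV_coord n i).
Proof. by move=> a u v; rewrite /rV_coord !mxE. Qed.
HB.instance Definition _ n i := GRing.isLinear.Build R 'rV[R]_n R^o *:%R
  (@rV_coord n i) (@rV_coord_linear n i).

Program Definition rV_framed n : framed 'rV[R]_n :=
  @Frame R 'rV[R]_n n (fun i => delta_mx 0 i)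
    (fun i => (@rV_coord n i : {linear 'rV[R]_n -> R^o})) _ _.
Next Obligation. by move=> n i x; exact: coord_continuous. Qed.
Next Obligation. by move=> n v; exact: row_sum_delta. Qed.
#[global] Existing Instance rV_framed.

Program Definition scalar_framed : framed R^o :=
  @Frame R R^o 1 (fun=> 1) (fun=> (idfun : {linear R^o -> R^o})) _ _.
Next Obligation. by move=> i x. Qed.
Next Obligation. by move=> v; rewrite big_ord1 [RHS]mulr1. Qed.
#[global] Existing Instance scalar_framed.

Section prod_frame.
Context {V W : normedModType R} {fV : framed V} {fW : framed W}.

Lemma pair_fst_linear : linear (@fst V W). Proof. by []. Qed.
HB.instance Definition _ := GRing.isLinear.Build R (V * W)%type V *:%R
  (@fst V W) pair_fst_linear.
Lemma pair_snd_linear : linear (@snd V W). Proof. by []. Qed.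
HB.instance Definition _ := GRing.isLinear.Build R (V * W)%type W *:%R
  (@snd V W) pair_snd_linear.

Definition pair_inl (v : V) : V * W := (v, 0).
Lemma pair_inl_linear : linear pair_inl.
Proof. by move=> a u v; apply: injective_projections; rewrite /= ?scaler0 ?addr0. Qed.
HB.instance Definition _ := GRing.isLinear.Build R V (V * W)%type *:%R
  pair_inl pair_inl_linear.
Definition pair_inr (w : W) : V * W := (0, w).
Lemma pair_inr_linear : linear pair_inr.
Proof. by move=> a u v; apply: injective_projections; rewrite /= ?scaler0 ?addr0. Qed.
HB.instance Definition _ := GRing.isLinear.Build R W (V * W)%type *:%R
  pair_inr pair_inr_linear.

Lemma pair_fst_continuous : continuous (@fst V W). Proof. by move=> x; exact: cvg_fst. Qed.
Lemma pair_snd_continuous : continuous (@snd V W). Proof. by move=> x; exact: cvg_snd. Qed.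
Lemma pair_inl_continuous : continuous pair_inl.
Proof. by move=> x; apply: cvg_pair; [exact: cvg_id|exact: cvg_cst]. Qed.
Lemma pair_inr_continuous : continuous pair_inr.
Proof. by move=> x; apply: cvg_pair; [exact: cvg_cst|exact: cvg_id]. Qed.

Definition prod_fco (i : 'I_(fdim V + fdim W)) : {linear (V * W)%type -> R^o} :=
  match fintype.split i with
  | inl j => fco j \o @fst V W
  | inr j => fco j \o @snd V W
  end.

Program Definition prod_framed : framed (V * W)%type :=
  @Frame R (V * W)%type (fdim V + fdim W)
    (fun i => match fintype.split i with
              | inl j => pair_inl (fvec j) | inr j => pair_inr (fvec j) end)
    prod_fco _ _.
Next Obligation.
move=> i; rewrite /prod_fco; case: (fintype.split i) => j x;
  apply: continuous_comp; try exact: fco_continuous.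
- exact: pair_fst_continuous.
- exact: pair_snd_continuous.
Qed.
Next Obligation.
move=> [v w]; rewrite big_split_ord /=.
rewrite (eq_bigr (fun j => pair_inl (fco j v *: fvec j))); last first.
  by move=> j _; rewrite /prod_fco (unsplitK (inl j)) /= linearZ.
rewrite [X in _ + X](eq_bigr (fun j => pair_inr (fco j w *: fvec j))); last first.
  by move=> j _; rewrite /prod_fco (unsplitK (inr j)) /= linearZ.
rewrite -!linear_sum -!fcoE.
by apply: injective_projections; rewrite /= ?addr0 ?add0r.
Qed.
End prod_frame.
#[global] Existing Instance prod_framed.

End frames.

Section Ck_calculus.
Context {R : realType}.
Implicit Types V W Z : normedModType R.

Lemma Ck_sub k V W (U U' : set V) (f : V -> W) :
  U' `<=` U -> Ck k U f -> Ck k U' f.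
Proof.
move=> UU'; elim: k f => [|k IH] f /=; first by move=> fc x /UU' /fc.
by move=> Cf v; split; [move=> x /UU'; exact: (Cf v).1|apply: IH; exact: (Cf v).2].
Qed.

Lemma Ck_local k V W (U : set V) (f : V -> W) :
  (forall x, U x -> exists2 A : set V, A x & Ck k A f) -> Ck k U f.
Proof.
elim: k f => [|k IH] f Of /=.
  by move=> x /Of[A Ax]; apply.
move=> v; split=> [x /Of[A Ax Cf]|]; first exact: (Cf v).1.
by apply: IH => x /Of[A Ax Cf]; exists A => //; exact: (Cf v).2.
Qed.

Lemma Ck_ext k V W (U : set V) (f g : V -> W) :
  open U -> (forall x, U x -> f x = g x) -> Ck k U f -> Ck k U g.
Proof.
move=> oU; elim: k f g => [|k IH] f g fg.
  move=> fc x Ux; change (g y @[y --> x] --> g x); rewrite -(fg x Ux).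
  have fgx : {near x, f =1 g}.
    by near=> y; apply: fg; near: y; exact: open_nbhs_nbhs.
  by apply: cvg_trans (fc x Ux); exact: near_eq_cvg.
move=> Cf v.
have fgx x : U x -> {near x, f =1 g}.
  by move=> Ux; near=> y; apply: fg; near: y; exact: open_nbhs_nbhs.
split=> [x Ux|]; first exact: near_eq_derivable (fgx x Ux) ((Cf v).1 x Ux).
apply: IH (Cf v).2 => x Ux; apply: near_eq_derive; exact: fgx.
Unshelve. all: by end_near. Qed.

Lemma Ck_cst k V W (U : set V) (w : W) : Ck k U (fun=> w).
Proof.
elim: k w => [|k IH] w; first by move=> x _; exact: cst_continuous.
move=> v; split; first by move=> x _; exact: derivable_cst.
by rewrite (_ : 'D_v _ = fun=> 0) //; apply/funext => x; exact: derive_cst.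
Qed.

Lemma CkD k V W (U : set V) (f g : V -> W) :
  open U -> Ck k U f -> Ck k U g -> Ck k U (f + g).
Proof.
move=> oU; elim: k f g => [|k IH] f g Cf Cg.
  by move=> x Ux; apply: cvgD; [exact: Cf|exact: Cg].
move=> v; have [df Df] := Cf v; have [dg Dg] := Cg v.
split=> [x Ux|]; first by apply: derivableD; [exact: df|exact: dg].
apply: (Ck_ext oU _ (IH _ _ Df Dg)) => x Ux.
by rewrite deriveD //; [exact: df|exact: dg].
Qed.

Lemma Ck_lin k V W Z (U : set V) (L : {linear W -> Z}) (f : V -> W) :
  open U -> continuous L -> Ck k U f -> Ck k U (L \o f).
Proof.
move=> oU Lc; elim: k f => [|k IH] f Cf.
  by move=> x Ux; apply: continuous_comp; [exact: Cf|exact: Lc].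
move=> v; have [df Df] := Cf v; split=> [x Ux|].
  by have [] := is_derive_lin Lc (df x Ux).
apply: (Ck_ext oU _ (IH _ Df)) => x Ux.
by have [_ ->] := is_derive_lin Lc (df x Ux).
Qed.

Lemma Ck_id k V (U : set V) : Ck k U (id : V -> V).
Proof.
case: k => [|k]; first by move=> x _.
move=> v; split; first by move=> x _; exact: derivable_id.
by rewrite (_ : 'D_v _ = fun=> v); [exact: Ck_cst|apply/funext => x; exact: derive_id].
Qed.

Lemma Ck_linear k V W (U : set V) (L : {linear V -> W}) :
  open U -> continuous L -> Ck k U L.
Proof. by move=> oU Lc; apply: (@Ck_lin k _ _ _ U L id) => //; exact: Ck_id. Qed.

Lemma Ck_sum k V W (U : set V) (I : Type) (s : seq I) (f : I -> V -> W) :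
  open U -> (forall i, Ck k U (f i)) -> Ck k U (fun x => \sum_(i <- s) f i x).
Proof.
move=> oU Cf; elim: s => [|i s IH].
  by apply: (Ck_ext oU _ (Ck_cst k U 0)) => x _; rewrite big_nil.
by apply: (Ck_ext oU _ (CkD oU (Cf i) IH)) => x _; rewrite big_cons.
Qed.

Lemma Ck_scalel k V W (U : set V) (f : V -> R^o) (w : W) :
  open U -> Ck k U f -> Ck k U (fun x => f x *: w).
Proof.
have scalel_linear : linear ( *:%R ^~ w : R^o -> W).
  by move=> a x y; rewrite scalerDl scalerA.
pose L : {linear R^o -> W} :=
  HB.pack ( *:%R ^~ w : R^o -> W) (GRing.isLinear.Build R R^o W *:%R _ scalel_linear).
by move=> oU; apply: (Ck_lin (L := L) oU); exact: scalel_continuous.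
Qed.

Lemma Ck_fco k V W {fW : framed W} (U : set V) (f : V -> W) :
  open U -> (forall i, Ck k U (fco i \o f : V -> R^o)) -> Ck k U f.
Proof.
move=> oU Cf; apply: (@Ck_ext _ _ _ _ (fun x => \sum_i fco i (f x) *: fvec i)) => //.
  by move=> x _; rewrite -fcoE.
by apply: Ck_sum => // i; apply: Ck_scalel => //; exact: Cf.
Qed.

Lemma C1_differentiable V W {fV : framed V} {fW : framed W} (U : set V) (f : V -> W) x :
  open U -> U x -> Ck 1 U f -> differentiable f x.
Proof.
move=> oU Ux C1f.
have -> : f = \sum_i (fun y => fco i (f y) *: fvec i).
  by apply/funext => y; rewrite fct_sumE {1}(fcoE (f y)).
apply: differentiable_sum => i; apply: differentiableZl.
apply: (@C1_differentiable_real _ _ fV U _ x oU Ux).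
by apply: Ck_lin oU _ C1f; exact: fco_continuous.
Qed.

Lemma Ck_pred k V W {fV : framed V} {fW : framed W} (U : set V) (f : V -> W) :
  open U -> Ck k.+1 U f -> Ck k U f.
Proof.
move=> oU; elim: k W fW f => [|k IH] W fW f Cf.
  by move=> x Ux; apply: differentiable_continuous; exact: (C1_differentiable oU Ux Cf).
by move=> v; split; [exact: (Cf v).1|apply: IH; exact: (Cf v).2].
Qed.

Lemma Ck_leq j k V W {fV : framed V} {fW : framed W} (U : set V) (f : V -> W) :
  open U -> (j <= k)%N -> Ck k U f -> Ck j U f.
Proof.
move=> oU; elim: k => [|k IH]; first by rewrite leqn0 => /eqP ->.
rewrite leq_eqVlt => /predU1P[-> //|]; rewrite ltnS => jk Cf.
by apply: IH jk _; exact: Ck_pred Cf.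
Qed.

Lemma CkM k V {fV : framed V} (U : set V) (f g : V -> R^o) :
  open U -> Ck k U f -> Ck k U g -> Ck k U (fun x => f x * g x : R^o).
Proof.
move=> oU; elim: k f g => [|k IH] f g Cf Cg.
  by move=> x Ux; apply: cvgM; [exact: Cf|exact: Cg].
move=> v; have [df Df] := Cf v; have [dg Dg] := Cg v.
split=> [x Ux|]; first by apply: derivableM; [exact: df|exact: dg].
pose proof (H := CkD oU (IH _ _ (Ck_pred oU Cf) Dg) (IH _ _ (Ck_pred oU Cg) Df)).
have HH := @Ck_ext k V R^o U _ ('D_v (fun x => f x * g x : R^o)) oU _ H.
apply: HH => x Ux.
by rewrite [RHS]deriveM //; [exact: df|exact: dg].
Qed.

Lemma derive_comp V W Z (f : V -> W) (g : W -> Z) x v :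
  differentiable f x -> differentiable g (f x) ->
  'D_v (g \o f) x = 'D_('D_v f x) g (f x).
Proof.
move=> df dg; rewrite (deriveE _ (differentiable_comp df dg)) (deriveE _ dg).
by rewrite (deriveE _ df) (diff_comp df dg).
Qed.

(** By the chain rule, each directional derivative of [g \o f] is a sum of
    products of coordinates of a derivative of [f] by partial derivatives of [g]
    along [f], to which the induction hypothesis applies. *)
Lemma Ck_comp k V W Z {fV : framed V} {fW : framed W} {fZ : framed Z}
    (U : set V) (U' : set W) (f : V -> W) (g : W -> Z) :
  open U -> open U' -> (forall x, U x -> U' (f x)) ->
  Ck k U f -> Ck k U' g -> Ck k U (g \o f).
Proof.
move=> oU oU' fU Cf Cg; apply: (@Ck_fco _ _ _ fZ) => // j.
have {Cg} : Ck k U' (fco j \o g : W -> R^o).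
  by apply: Ck_lin Cg => //; exact: fco_continuous.
change (fco j \o (g \o f)) with ((fco j \o g) \o f).
move: (_ \o g : W -> R^o) => {}g Cg.
elim: k f g Cf Cg fU => [|k IH] f g Cf Cg fU.
  by move=> x Ux; apply: continuous_comp; [exact: Cf|apply: Cg; exact: fU].
have df x : U x -> differentiable f x.
  by move=> Ux; apply: (C1_differentiable oU Ux); exact: (Ck_leq oU (isT : (1 <= k.+1)%N) Cf).
have C1g : Ck 1 U' g by exact: (Ck_leq oU' (isT : (1 <= k.+1)%N) Cg).
have dg y : U' y -> differentiable g y.
  by move=> U'y; exact: (C1_differentiable oU' U'y).
move=> v; split=> [x Ux|].
  by apply: diff_derivable; exact: (differentiable_comp (df x Ux) (dg _ (fU x Ux))).
apply: (@Ck_ext _ _ _ _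
    (fun x => \sum_i (fco i ('D_v f x) * 'D_(fvec i) g (f x) : R^o))) => //.
  move=> x Ux; rewrite [RHS](derive_comp v (df x Ux) (dg _ (fU x Ux))).
  by rewrite [RHS](derive_fco _ oU' (fU _ Ux) C1g).
apply: Ck_sum => // i; apply: CkM => //.
  by apply: (@Ck_lin _ _ _ _ _ (fco i)) => //; [exact: fco_continuous|exact: (Cf v).2].
exact: (IH f ('D_(fvec i) g) (Ck_pred oU Cf) (Cg _).2 fU).
Qed.

Lemma Ck_pair k V W Z (U : set V) (f : V -> W) (g : V -> Z) :
  open U -> Ck k U f -> Ck k U g -> Ck k U (fun x => (f x, g x)).
Proof.
move=> oU Cf Cg.
pose proof (Cfg := CkD oU (Ck_lin oU (@pair_inl_continuous R W Z) Cf)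
  (Ck_lin oU (@pair_inr_continuous R W Z) Cg)).
apply: (Ck_ext oU _ Cfg).
by move=> x _; apply: injective_projections; rewrite /= ?addr0 ?add0r.
Qed.

End Ck_calculus.

(** * Maps of class C^k between manifolds *)
Section charts.
Context {R : realType} {T : topologicalType} {E : normedModType R}.
Implicit Types c : chart T E.

Lemma chart_image c (A : set T) : is_chart c ->
  cmap c @` (cdom c `&` A) = [set v | chart_img c v /\ A (cinv c v)].
Proof.
move=> [_ K _ _]; apply/seteqP; split=> v /=.
  by move=> [x [cx Ax] <-]; split; [exists x|rewrite K].
by move=> [[x cx <-]]; rewrite K // => Ax; exists x.
Qed.

Lemma cinvK c v : is_chart c -> chart_img c v ->
  cdom c (cinv c v) /\ cmap c (cinv c v) = v.
Proof. by move=> [_ K _ _] [x cx <-]; rewrite K. Qed.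

Lemma chart_img_open c : is_chart c -> open (chart_img c).
Proof. by move=> [[]]. Qed.

Lemma chart_image_open c (A : set T) : is_chart c -> open A ->
  open (cmap c @` (cdom c `&` A)).
Proof.
move=> cc oA; rewrite chart_image // openE => v [cv Av].
have cinvc : {for v, continuous (cinv c)} by case: cc => _ _ _; exact.
apply: filterI; first by apply: open_nbhs_nbhs; split => //; exact: chart_img_open.
by apply: cinvc; exact: open_nbhs_nbhs.
Qed.

(** The part of [smooth_atlas] that does not involve changes of charts. *)
Definition covering_charts (A : set (chart T E)) : Prop :=
  (forall c, A c -> is_chart c) /\ (forall x, exists2 c, A c & cdom c x).

Lemma smooth_covering (A : set (chart T E)) : smooth_atlas A -> covering_charts A.
Proof. by case. Qed.

End charts.

Lemma openX {S T : topologicalType} (A : set S) (B : set T) :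
  open A -> open B -> open (A `*` B).
Proof.
move=> oA oB; rewrite openE => -[x y] [/= Ax By].
by exists (A, B) => //=; split; exact: open_nbhs_nbhs.
Qed.

Section chart_constructions.
Context {R : realType}.

Definition flat_atlas (E : normedModType R) : set (chart E E) :=
  [set Chart setT id id].
Arguments flat_atlas : clear implicits.

Lemma flat_is_chart (E : normedModType R) :
  is_chart (Chart setT id id : chart E E).
Proof.
split=> [|//|x _|x _]; try exact: cvg_id.
split; first exact: openT.
by rewrite /chart_img /= image_id; exact: openT.
Qed.

Lemma flat_covering (E : normedModType R) : covering_charts (flat_atlas E).
Proof.
split=> [c ->|x]; first exact: flat_is_chart.
by exists (Chart setT id id).
Qed.

Lemma line_covering : covering_charts (@line_atlas R).
Proof. exact: flat_covering. Qed.

Lemma prod_is_chart {M N : topologicalType} {E E' : normedModType R}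
    (c : chart M E) (d : chart N E') :
  is_chart c -> is_chart d -> is_chart (prod_chart c d).
Proof.
move=> cc dd; have [[oc oci] Kc cmc cic] := cc; have [[od odi] Kd cmd cid] := dd.
have imgE : chart_img (prod_chart c d) = chart_img c `*` chart_img d.
  apply/seteqP; split=> [_ [[x y] [/= cx dy] <-]|[u v] /= [[x cx <-] [y dy <-]]].
    by split; [exists x|exists y].
  by exists (x, y).
split; first split; rewrite ?imgE; try exact: openX.
- by move=> [x y] /= [cx dy]; rewrite Kc // Kd.
- move=> [x y] /= [cx dy]; apply: cvg_pair => /=.
  + by apply: (cvg_comp fst (cmap c)); [exact: cvg_fst|exact: cmc].
  + by apply: (cvg_comp snd (cmap d)); [exact: cvg_snd|exact: cmd].
- move=> [x y] /= [cx dy]; apply: cvg_pair => /=.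
  + by apply: (cvg_comp fst (cinv c)); [exact: cvg_fst|exact: cic].
  + by apply: (cvg_comp snd (cinv d)); [exact: cvg_snd|exact: cid].
Qed.

Lemma prod_covering {M N : topologicalType} {E E' : normedModType R}
    (A : set (chart M E)) (B : set (chart N E')) :
  covering_charts A -> covering_charts B -> covering_charts (prod_atlas A B).
Proof.
move=> [Ac Ax] [Bc Bx]; split.
  by move=> _ [c cA [d dB <-]]; apply: prod_is_chart; [exact: Ac|exact: Bc].
move=> [x y]; have [c cA cx] := Ax x; have [d dB dy] := Bx y.
by exists (prod_chart c d) => //; exists c => //; exists d.
Qed.

End chart_constructions.

Arguments flat_atlas {R} E.

Section smooth_maps.
Context {R : realType}.
Context {M N P : topologicalType} {E E' E'' : normedModType R}.
Context {fE : framed E} {fE' : framed E'} {fE'' : framed E''}.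
Context {A : set (chart M E)} {B : set (chart N E')} {C : set (chart P E'')}.
Hypotheses (covA : covering_charts A) (covB : covering_charts B)
  (covC : covering_charts C).

Lemma Ck_map_dom_open (f : M -> N) c d : A c -> B d -> continuous f ->
  open (cmap c @` (cdom c `&` f @^-1` cdom d)).
Proof.
move=> Ac Bd fc; apply: chart_image_open; first exact: covA.1.
by apply: open_comp; [move=> x _; exact: fc|case: (covB.1 _ Bd) => -[]].
Qed.

(** In charts, [g \o f] agrees near each point with the composition of [f] and
    [g] read through a common chart at the image point. *)
Lemma Ck_map_comp k (f : M -> N) (g : N -> P) :
  Ck_map k A B f -> Ck_map k B C g -> Ck_map k A C (g \o f).
Proof.
move=> [fc Cf] [gc Cg].
have gfc : continuous (g \o f) by move=> x; apply: continuous_comp; [exact: fc|exact: gc].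
split=> // c d Ac Cd; apply: Ck_local => _ [x [cx dgfx] <-].
have [b Bb bfx] := covB.2 (f x).
have [[oc _] Kc _ _] := covA.1 c Ac; have [[ob _] Kb _ _] := covB.1 b Bb.
have [[od _] _ _ _] := covC.1 d Cd.
pose O := cdom c `&` (f @^-1` cdom b `&` (g \o f) @^-1` cdom d).
exists (cmap c @` O); first by exists x.
have oO : open (cmap c @` O).
  apply: chart_image_open; first exact: covA.1.
  by apply: openI; [exact: (continuousP f).1 fc _ ob|exact: (continuousP (g \o f)).1 gfc _ od].
have Cg' := Cg _ _ Bb Cd.
have Cf' : Ck k (cmap c @` O) (cmap b \o f \o cinv c).
  by apply: Ck_sub (Cf _ _ Ac Bb) => _ [y [cy [by_ dy]] <-]; exists y.
have ob' : open (cmap b @` (cdom b `&` g @^-1` cdom d)).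
  apply: chart_image_open; first exact: covB.1.
  exact: (continuousP g).1 gc _ od.
have fO v : (cmap c @` O) v ->
    (cmap b @` (cdom b `&` g @^-1` cdom d)) ((cmap b \o f \o cinv c) v).
  by move=> [y [cy [by_ dy]] <-] /=; rewrite Kc //; exists (f y).
apply: (Ck_ext oO _ (Ck_comp oO ob' fO Cf' Cg')).
by move=> _ [y [cy [by_ dy]] <-] /=; rewrite Kc // Kb.
Qed.

Lemma Ck_map_cst k (y : N) : Ck_map k A B (fun _ : M => y).
Proof. by split=> [x|c d _ _]; [exact: cvg_cst|exact: Ck_cst]. Qed.

Lemma Ck_map_pair k (f : M -> N) (g : M -> P) :
  Ck_map k A B f -> Ck_map k A C g ->
  Ck_map k A (prod_atlas B C) (fun x => (f x, g x)).
Proof.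
move=> [fc Cf] [gc Cg].
have fgc : continuous (fun x => (f x, g x)).
  by move=> x; apply: cvg_pair; [exact: fc|exact: gc].
split=> // c _ Ac [d Bd [e Ce <-]].
have oO : open (cmap c @` (cdom c `&` (f @^-1` cdom d `&` g @^-1` cdom e))).
  apply: chart_image_open; first exact: covA.1.
  apply: openI.
  + by apply: (continuousP f).1 fc _ _; case: (covB.1 _ Bd) => -[].
  + by apply: (continuousP g).1 gc _ _; case: (covC.1 _ Ce) => -[].
apply: Ck_pair => //.
- by apply: Ck_sub (Cf _ _ Ac Bd) => _ [y [cy [dy ey]] <-]; exists y.
- by apply: Ck_sub (Cg _ _ Ac Ce) => _ [y [cy [dy ey]] <-]; exists y.
Qed.

(** Continuity comes for free: it is the C^0 part of the hypothesis. *)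
Lemma Ck_map_flat k (f : M -> E') :
  (forall c, A c -> Ck k (chart_img c) (f \o cinv c)) ->
  Ck_map k A (flat_atlas E') f.
Proof.
move=> Cf; split.
  move=> x; have [c Ac cx] := covA.2 x; have cc := covA.1 c Ac.
  have [[oc oi] Kc cmc cic] := cc.
  have cimg : chart_img c (cmap c x) by exists x.
  have C0 : Ck 0 (chart_img c) (f \o cinv c) by apply: Ck_leq (Cf c Ac).
  have feq : {near x, ((f \o cinv c) \o cmap c) =1 f}.
    near=> y; rewrite /= Kc //; near: y; exact: open_nbhs_nbhs.
  have : ((f \o cinv c) \o cmap c) y @[y --> x] --> f x.
    rewrite -{2}(Kc x cx).
    by apply: (cvg_comp (cmap c) (f \o cinv c)); [exact: cmc|exact: C0].
  by apply: cvg_trans; exact: near_eq_cvg feq.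
move=> c d Ac ->; apply: Ck_sub (Cf c Ac) => _ [x [cx _] <-]; by exists x.
Unshelve. all: by end_near. Qed.

Lemma Ck_flat_chart k (f : M -> E') c : A c -> Ck_map k A (flat_atlas E') f ->
  Ck k (chart_img c) (f \o cinv c).
Proof.
move=> Ac [_ /(_ c _ Ac erefl)]; apply: Ck_sub => _ [x cx <-].
by exists x.
Qed.

Lemma chart_differentiable (f : M -> N) c d x :
  A c -> B d -> cdom c x -> cdom d (f x) -> Ck_map 1 A B f ->
  differentiable (cmap d \o f \o cinv c) (cmap c x).
Proof.
move=> Ac Bd cx dfx [fc /(_ c d Ac Bd)]; apply: C1_differentiable.
  exact: Ck_map_dom_open.
by exists x.
Qed.

End smooth_maps.

Section smooth_projections.
Context {R : realType} {M N : topologicalType} {E E' : normedModType R}.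
Context {fE : framed E} {fE' : framed E'}.
Context {A : set (chart M E)} {B : set (chart N E')}.
Hypotheses (smA : smooth_atlas A) (smB : smooth_atlas B).

Let covA := smooth_covering smA.
Let covB := smooth_covering smB.

Lemma Ck_map_id k : Ck_map k A A id.
Proof. by case: smA => _ _ smk; split=> [x|c d Ac Ad]; [exact: cvg_id|exact: smk]. Qed.

Lemma Ck_map_fst k : Ck_map k (prod_atlas A B) A fst.
Proof.
have fc : continuous (@fst M N) by move=> x; exact: cvg_fst.
split=> // _ e [c Ac [d Bd <-]] Ae.
have [[oc oci] Kc cmc cic] := covA.1 c Ac.
have oU := Ck_map_dom_open (prod_covering covA covB) covA
  (ex_intro2 _ _ c Ac (ex_intro2 _ _ d Bd erefl)) Ae fc.
have [_ _ /(_ c e k Ac Ae) Cce] := smA.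
have oU' : open (cmap c @` (cdom c `&` cdom e)).
  by apply: chart_image_open; [exact: covA.1|case: (covA.1 _ Ae) => -[]].
have UU' v : (cmap (prod_chart c d) @` (cdom (prod_chart c d) `&` fst @^-1` cdom e)) v ->
    (cmap c @` (cdom c `&` cdom e)) v.1.
  by move=> [[x y] [[cx dy] ex] <-]; exists x.
exact: (Ck_comp oU oU' UU' (Ck_linear _ oU (@pair_fst_continuous R E E')) Cce).
Qed.

Lemma Ck_map_snd k : Ck_map k (prod_atlas A B) B snd.
Proof.
have fc : continuous (@snd M N) by move=> x; exact: cvg_snd.
split=> // _ e [c Ac [d Bd <-]] Be.
have oU := Ck_map_dom_open (prod_covering covA covB) covB
  (ex_intro2 _ _ c Ac (ex_intro2 _ _ d Bd erefl)) Be fc.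
have [_ _ /(_ d e k Bd Be) Cde] := smB.
have oU' : open (cmap d @` (cdom d `&` cdom e)).
  by apply: chart_image_open; [exact: covB.1|case: (covB.1 _ Be) => -[]].
have UU' v : (cmap (prod_chart c d) @` (cdom (prod_chart c d) `&` snd @^-1` cdom e)) v ->
    (cmap d @` (cdom d `&` cdom e)) v.2.
  by move=> [[x y] [[cx dy] ey] <-]; exists y.
exact: (Ck_comp oU oU' UU' (Ck_linear _ oU (@pair_snd_continuous R E E')) Cde).
Qed.

End smooth_projections.

Lemma flat_smooth {R : realType} (E : normedModType R) : smooth_atlas (flat_atlas E).
Proof.
have [h1 h2] := flat_covering E; split=> // _ _ k -> ->; exact: Ck_id.
Qed.

(** * The adjoint representation *)
Section slices.
Context {R : realType} {V W Z : normedModType R}.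

Lemma derive_slice_l (f : V * W -> Z) u w v :
  'D_v (fun y => f (y, w)) u = 'D_(v, 0) f (u, w).
Proof.
rewrite /derive; congr (lim (_ @ 0^')); apply/funext => h /=.
by rewrite (_ : h *: (v, 0) + (u, w) = (h *: v + u, w)) //;
  apply: injective_projections; rewrite /= ?scaler0 ?add0r.
Qed.

Lemma derive_slice_r (f : V * W -> Z) u w v :
  'D_v (fun y => f (u, y)) w = 'D_(0, v) f (u, w).
Proof.
rewrite /derive; congr (lim (_ @ 0^')); apply/funext => h /=.
by rewrite (_ : h *: (0, v) + (u, w) = (u, h *: v + w)) //;
  apply: injective_projections; rewrite /= ?scaler0 ?add0r.
Qed.

End slices.

Section tangent_maps.
Context {R : realType}.

Definition tangent_map {M N : Type} {E E' : normedModType R} (c : chart M E)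
    (d : chart N E') (f : M -> N) (x : M) (v : E) : E' :=
  'D_v (cmap d \o f \o cinv c) (cmap c x).

Context {M N P : topologicalType} {E E' E'' : normedModType R}.
Context {fE : framed E} {fE' : framed E'} {fE'' : framed E''}.
Context {A : set (chart M E)} {B : set (chart N E')} {C : set (chart P E'')}.
Hypotheses (covA : covering_charts A) (covB : covering_charts B)
  (covC : covering_charts C).

Lemma tangent_map_linear (f : M -> N) c d x : A c -> B d -> cdom c x -> cdom d (f x) ->
  Ck_map 1 A B f -> linear (tangent_map c d f x).
Proof.
move=> Ac Bd cx dfx Cf a u v; rewrite /tangent_map.
pose proof (df := chart_differentiable covA covB Ac Bd cx dfx Cf).
by rewrite !(deriveE _ df) linearP.
Qed.

Lemma tangent_map_comp (f : M -> N) (g : N -> P) c d e x v :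
  A c -> B d -> C e -> cdom c x -> cdom d (f x) -> cdom e (g (f x)) ->
  Ck_map 1 A B f -> Ck_map 1 B C g ->
  tangent_map c e (g \o f) x v = tangent_map d e g (f x) (tangent_map c d f x v).
Proof.
move=> Ac Bd Ce cx dfx egfx Cf Cg.
pose proof (df := chart_differentiable covA covB Ac Bd cx dfx Cf).
pose proof (dg := chart_differentiable covB covC Bd Ce dfx egfx Cg).
have [[oc _] Kc _ _] := covA.1 c Ac; have [[od _] Kd _ _] := covB.1 d Bd.
rewrite /tangent_map.
have E0 : (cmap d \o f \o cinv c) (cmap c x) = cmap d (f x) by rewrite /= Kc.
rewrite -{}E0 in dg *.
rewrite -(derive_comp v df dg); apply: near_eq_derive.
have oO : open (cmap c @` (cdom c `&` f @^-1` cdom d)).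
  by apply: (Ck_map_dom_open covA covB Ac Bd); case: Cf.
near=> y.
have [z [cz dz] <-] : (cmap c @` (cdom c `&` f @^-1` cdom d)) y.
  by near: y; apply: open_nbhs_nbhs; split=> //; exists x.
by rewrite /= Kc // Kd.
Unshelve. all: by end_near. Qed.

Lemma tangent_map_id c x v : A c -> cdom c x -> tangent_map c c id x v = v.
Proof.
move=> Ac cx; rewrite /tangent_map -[RHS](derive_id (cmap c x) v).
have [[oc oi] Kc _ _] := covA.1 c Ac.
apply: near_eq_derive; near=> y.
have [z cz <-] : chart_img c y.
  by near: y; apply: open_nbhs_nbhs; split=> //; exists x.
by rewrite /= Kc.
Unshelve. all: by end_near. Qed.

Lemma tangent_map_cst (y : N) (c : chart M E) (d : chart N E') x v :
  tangent_map c d (fun _ : M => y) x v = 0.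
Proof. exact: derive_cst. Qed.

End tangent_maps.

Section locally_constant.
Context {R : realType} {V : normedModType R}.

Lemma derive0_cst (f : V -> R^o) (x y : V) (r : R) :
  (forall z v, ball x r z -> derivable f z v /\ 'D_v f z = 0) ->
  ball x r y -> f y = f x.
Proof.
move=> df xy; apply/eqP; rewrite -subr_eq0.
have xt (t : R) : 0 <= t <= 1 -> ball x r (x + t *: (y - x)).
  move: xy; rewrite -!ball_normE /= => xy /andP[t0 t1].
  rewrite opprD addrA subrr sub0r normrN normrZ ger0_norm // distrC in xy *.
  by apply: le_lt_trans xy; rewrite distrC ler_piMl.
have [|t t01] := @mean_value _ _ f x (y - x).
  by move=> t /xt xt'; exact: (df _ _ xt').1.
by rewrite addrCA subrr addr0 => ->; rewrite (df _ _ (xt _ t01)).2.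
Qed.

End locally_constant.

Section adjoint_representation.
Context {R : realType} {G : ptopGroupType} {n : nat}.
Context {AG : set (chart G 'rV[R]_n)} (G_lie : compact_lie_group AG).
Context {c : chart G 'rV[R]_n} (AGc : AG c) (c1 : cdom c 1%g).

Lemma lie_smooth : smooth_atlas AG.
Proof. by case: G_lie => -[]. Qed.
Let smG := lie_smooth.
Let covG := smooth_covering lie_smooth.
Let covGG := prod_covering covG covG.

Lemma mul_Ck k : Ck_map k (prod_atlas AG AG) AG (fun p : G * G => p.1 * p.2)%g.
Proof. by case: G_lie. Qed.

Lemma inv_Ck k : Ck_map k AG AG (fun g : G => g^-1)%g.
Proof. by case: G_lie. Qed.

Lemma Ck_map_mul {M : topologicalType} {E : normedModType R} {fE : framed E}
    {A : set (chart M E)} (covA : covering_charts A) k (f g : M -> G) :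
  Ck_map k A AG f -> Ck_map k A AG g -> Ck_map k A AG (fun x => f x * g x)%g.
Proof.
move=> Cf Cg; pose proof (Cfg := Ck_map_pair covA covG covG Cf Cg).
exact: (Ck_map_comp covA covGG covG Cfg (mul_Ck k)).
Qed.

Lemma Ck_map_inv {M : topologicalType} {E : normedModType R} {fE : framed E}
    {A : set (chart M E)} (covA : covering_charts A) k (f : M -> G) :
  Ck_map k A AG f -> Ck_map k A AG (fun x => (f x)^-1)%g.
Proof. by move=> Cf; exact: (Ck_map_comp covA covG covG Cf (inv_Ck k)). Qed.

Definition conj_map (p : G * G) : G := (p.1 * p.2 * p.1^-1)%g.

Lemma conj_Ck k : Ck_map k (prod_atlas AG AG) AG conj_map.
Proof.
pose proof (f1 := Ck_map_fst smG smG k); pose proof (f2 := Ck_map_snd smG smG k).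
by apply: Ck_map_mul => //; [exact: mul_Ck|exact: Ck_map_inv].
Qed.

Lemma inner_Ck k g : Ck_map k AG AG (fun h => g * h * g^-1)%g.
Proof.
apply: Ck_map_mul => //; last exact: Ck_map_cst.
by apply: Ck_map_mul => //; [exact: Ck_map_cst|exact: Ck_map_id].
Qed.

Lemma inner1 g : (g * 1 * g^-1)%g = 1%g :> G.
Proof. by rewrite mulg1 mulgV. Qed.

Lemma Ad_tangent_map g Z : Ad c g Z = tangent_map c c (fun h => g * h * g^-1)%g 1%g Z.
Proof. by []. Qed.

Lemma Ad_linear g : linear (Ad c g).
Proof.
move=> a u v; rewrite !Ad_tangent_map.
by apply: (tangent_map_linear covG covG AGc AGc c1) => //; rewrite ?inner1 //; exact: inner_Ck.
Qed.

Lemma Ad_mul g h Z : Ad c (g * h)%g Z = Ad c g (Ad c h Z).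
Proof.
rewrite !Ad_tangent_map.
rewrite (_ : (fun k => _) = (fun k => g * k * g^-1)%g \o (fun k => h * k * h^-1)%g).
  rewrite (tangent_map_comp covG covG covG _ AGc AGc AGc c1) ?inner1 //; exact: inner_Ck.
by apply/funext => k /=; rewrite invgM !mulgA.
Qed.

Lemma Ad_1 Z : Ad c 1%g Z = Z.
Proof.
rewrite Ad_tangent_map (_ : (fun h => _) = id); first exact: (tangent_map_id covG).
by apply/funext => h; rewrite invg1 mulg1 mul1g.
Qed.

Lemma AdK g Z : Ad c g^-1%g (Ad c g Z) = Z.
Proof. by rewrite -Ad_mul mulVg Ad_1. Qed.

(** [Ad_g Z] is the partial derivative of [(g, h) |-> g h g^-1] at [h = 1] in
    the direction [Z], and conjugation is of class C^(k+1). *)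
Lemma Ad_smooth k Z : Ck_map k AG (flat_atlas 'rV[R]_n) (fun g => Ad c g Z).
Proof.
apply: Ck_map_flat => // d AGd.
pose U := cmap (prod_chart d c) @` (cdom (prod_chart d c) `&` conj_map @^-1` cdom c).
pose Q := cmap c \o conj_map \o cinv (prod_chart d c).
have AGdc : prod_atlas AG AG (prod_chart d c) by exists d => //; exists c.
have oU : open U by apply: (Ck_map_dom_open covGG covG AGdc AGc); case: (conj_Ck 0).
have CQ : Ck k.+1 U Q by exact: (conj_Ck k.+1).2.
have oi := chart_img_open (covG.1 _ AGd).
have [_ Kd _ _] := covG.1 _ AGd; have [_ Kc _ _] := covG.1 _ AGc.
have uU u : chart_img d u -> U (u, cmap c 1%g).
  move=> [g dg <-]; exists (g, 1%g) => //; split => //=.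
  by rewrite /conj_map /= inner1.
have Cu : Ck k (chart_img d) (fun u : 'rV[R]_n => (u, cmap c 1%g)).
  by apply: Ck_pair => //; [exact: Ck_id|exact: Ck_cst].
apply: (Ck_ext oi _ (Ck_comp oi oU uU Cu (CQ (0, Z)).2)) => u du.
by rewrite [LHS]/= -derive_slice_r.
Qed.

Lemma Ad_continuous Z : continuous (fun g => Ad c g Z).
Proof. by case: (Ad_smooth 0 Z). Qed.

Lemma bracket_tangent_map W Z :
  bracket c W Z = tangent_map c (Chart setT id id) (fun g => Ad c g Z) 1%g W.
Proof. by []. Qed.

Lemma mulg_continuous (g : G) : continuous (fun h => g * h)%g.
Proof.
have [mc _] := mul_Ck 0; move=> h.
have gc : (fun h' : G => (g, h')) @ h --> (g, h).
  by apply: cvg_pair; [exact: cvg_cst|exact: cvg_id].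
exact: (cvg_comp _ _ gc (mc (g, h))).
Qed.

(** [Ad_h Z = Ad_g (Ad_(g^-1 h) Z)], so the derivative at [h = g] is the image
    by [Ad_g] of a derivative at the identity, that is, of a bracket with [Z]. *)
Lemma Ad_derive0 Z d g v : AG d -> cdom d g ->
  (forall W, bracket c W Z = 0) ->
  tangent_map d (Chart setT id id) (fun h => Ad c h Z) g v = 0.
Proof.
move=> AGd dg Z0.
have flatV := flat_covering 'rV[R]_n.
pose AdZ h := Ad c h Z.
have -> : (fun h => Ad c h Z) = Ad c g \o (AdZ \o (fun h => g^-1 * h)%g).
  by apply/funext => h /=; rewrite /AdZ -Ad_mul mulgA mulgV mul1g.
have CL : Ck_map 1 AG AG (fun h => g^-1 * h)%g.
  by apply: Ck_map_mul => //; [exact: Ck_map_cst|exact: Ck_map_id].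
have CLZ : Ck_map 1 AG (flat_atlas 'rV[R]_n) (AdZ \o (fun h => g^-1 * h)%g).
  exact: (Ck_map_comp covG covG flatV CL (Ad_smooth 1 Z)).
pose Adg : {linear 'rV[R]_n -> 'rV[R]_n} :=
  HB.pack (Ad c g) (GRing.isLinear.Build R _ _ _ (Ad c g) (Ad_linear g)).
have Adgc : continuous Adg.
  move=> x.
  have dAd : differentiable (cmap c \o (fun h => g * h * g^-1)%g \o cinv c) (cmap c 1%g).
    by apply: (chart_differentiable covG covG AGc AGc c1); rewrite ?inner1 //; exact: inner_Ck.
  have E : (Adg : 'rV[R]_n -> 'rV[R]_n) =
      'd (cmap c \o (fun h => g * h * g^-1)%g \o cinv c) (cmap c 1%g).
    by apply/funext => u; rewrite -deriveE.
  by rewrite E; exact: diff_continuous.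
pose proof (dLZ := chart_differentiable covG flatV AGd erefl dg I CLZ).
have [_ E] := is_derive_lin Adgc (diff_derivable (v := v) dLZ).
rewrite /tangent_map; transitivity (Adg ('D_v (AdZ \o (fun h => g^-1 * h)%g \o cinv d) (cmap d g))).
  by rewrite -[RHS]E.
have cg1 : cdom c (g^-1 * g)%g by rewrite mulVg.
pose proof (E2 := tangent_map_comp covG covG flatV v AGd AGc erefl dg cg1 I CL (Ad_smooth 1 Z)).
have E3 W : tangent_map c (Chart setT id id) AdZ (g^-1 * g)%g W = 0.
  by rewrite mulVg; exact: Z0.
by move: E2; rewrite E3 => E2; transitivity (Adg 0); [congr (Adg _)|exact: (linear0 Adg)].
Qed.

Lemma Ad_locally_cst Z : (forall W, bracket c W Z = 0) ->
  \forall g \near (1%g : G), Ad c g Z = Z.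
Proof.
move=> Z0; have [[oc oi] Kc cmc cic] := covG.1 c AGc.
have [r r0 rc] : exists2 r : R, 0 < r & ball (cmap c 1%g) r `<=` chart_img c.
  by apply/nbhs_ballP; apply: open_nbhs_nbhs; split=> //; exists 1%g.
have fr v : ball (cmap c 1%g) r v -> Ad c (cinv c v) Z = Z.
  move=> bv; rewrite -[RHS]Ad_1 -(Kc 1%g c1).
  apply/rowP => j.
  apply: (@derive0_cst _ _ (fun v => Ad c (cinv c v) Z 0 j : R^o) _ _ r) => // z w bz.
  have [g cg gz] := rc _ bz.
  have dz : differentiable ((fun g => Ad c g Z) \o cinv c) z.
    rewrite -gz.
    exact: (chart_differentiable covG (flat_covering _) AGc erefl cg I (Ad_smooth 1 Z)).
  have [h1 h2] := is_derive_lin (L := @rV_coord R n j : {linear _ -> _})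
    (@coord_continuous _ _ _ _ _) (diff_derivable (v := w) dz).
  split=> //.
  rewrite -[LHS]/('D_w (@rV_coord R n j \o ((fun g => Ad c g Z) \o cinv c)) z) h2.
  have := Ad_derive0 w AGc cg Z0; rewrite /tangent_map gz /= => E.
  by rewrite -[X in rV_coord _ X]/('D_w (id \o (fun g => Ad c g Z) \o cinv c) z) E linear0.
have : \forall g \near (1%g : G), cdom c g /\ ball (cmap c 1%g) r (cmap c g).
  apply: filterI; first exact: open_nbhs_nbhs.
  by apply: (cmc 1%g c1); exact: nbhsx_ballx.
by apply: filterS => g [cg bg]; rewrite -{1}(Kc g cg); exact: fr.
Qed.

Lemma bracket_fixed W Z : Ad_fixed c Z -> bracket c W Z = 0.
Proof.
move=> ZA; rewrite bracket_tangent_map.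
rewrite (_ : (fun g => Ad c g Z) = fun=> Z); first exact: tangent_map_cst.
by apply/funext => g; exact: ZA.
Qed.

(** The stabiliser of a central [Z] is open, as it contains a neighbourhood of
    the identity, and its complement is open for the same reason. *)
Lemma Ad_fixed_center : connected [set: G] ->
  Ad_fixed c = lie_center (bracket c) [set: 'rV[R]_n].
Proof.
move=> conG; apply/seteqP; split=> Z.
  by move=> ZA; split=> // W _; exact: bracket_fixed.
move=> [_ Z0] g.
have Z0' W : bracket c W Z = 0 by exact: Z0.
pose S := [set g : G | Ad c g Z = Z].
(* near every h, the vectors Ad_k Z are all equal to Ad_h Z *)
have nbS (h : G) : \forall k \near h, Ad c (h^-1 * k)%g Z = Z.
  have : (fun k => h^-1 * k)%g @ h --> (1%g : G).
    by rewrite -(mulVg h); exact: mulg_continuous.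
  by move=> /(_ _ (Ad_locally_cst Z0')).
have SE (h k : G) : Ad c (h^-1 * k)%g Z = Z -> Ad c k Z = Ad c h Z.
  by move=> E; rewrite -[in RHS]E -Ad_mul mulgA mulgV mul1g.
suff : S = setT by move=> /seteqP[_ /(_ g)]; exact.
apply: conG.
- by exists 1%g; exact: Ad_1.
- exists S; last by rewrite setTI.
  rewrite openE => h hS; have := nbS h; apply: filterS => k E.
  by rewrite /S /= (SE _ _ E).
- exists S; last by rewrite setTI.
  have -> : S = ~` ~` S by rewrite setCK.
  apply: open_closedC; rewrite openE => h hS; have := nbS h; apply: filterS => k E.
  by apply: contra_not hS; rewrite /S /= (SE _ _ E).
Qed.

End adjoint_representation.

(** * Continuity of the velocity field of the cocycle *)
Section velocity.
Context {R : realType} {X : ptopologicalType} {dX : nat}.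
Context {AX : set (chart X 'rV[R]_dX)} {F : R -> X -> X}.
Context {G : ptopGroupType} {n : nat} {AG : set (chart G 'rV[R]_n)}.
Context {c : chart G 'rV[R]_n} {phi : X -> G}.
Hypotheses (smX : smooth_atlas AX) (F_flow : C1_flow AX F)
  (G_lie : compact_lie_group AG) (AGc : AG c) (c1 : cdom c 1%g)
  (C1phi : Ck_map 1 AX AG phi).

Let covX := smooth_covering smX.
Let covG := smooth_covering (lie_smooth G_lie).
Let covRX := prod_covering (@line_covering R) covX.

(** [M_phi x] is the partial derivative at [t = 0] of the C^1 map
    [(t, x) |-> phi (F_t x) * (phi x)^-1]. *)
Lemma M_continuous : continuous (M_ F c phi).
Proof.
have [F0 _ CF] := F_flow.
pose Phi (p : R * X) := (phi (F p.1 p.2) * (phi p.2)^-1)%g.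
have CPhi : Ck_map 1 (prod_atlas line_atlas AX) AG Phi.
  apply: (Ck_map_mul G_lie covRX).
    exact: (Ck_map_comp covRX covX covG CF C1phi).
  apply: (Ck_map_inv G_lie covRX).
  apply: (Ck_map_comp covRX covX covG _ C1phi).
  exact: (Ck_map_snd (flat_smooth R^o) smX 1).
suff [] : Ck_map 0 AX (flat_atlas 'rV[R]_n) (M_ F c phi) by [].
apply: (Ck_map_flat covX) => d AXd.
pose L : chart R R^o := Chart setT id id.
have ALd : prod_atlas line_atlas AX (prod_chart L d) by exists L => //; exists d.
pose H := cmap c \o Phi \o cinv (prod_chart L d).
pose U := cmap (prod_chart L d) @` (cdom (prod_chart L d) `&` Phi @^-1` cdom c).
have oU : open U by apply: (Ck_map_dom_open covRX covG ALd AGc); case: CPhi.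
have CH : Ck 1 U H by exact: CPhi.2.
have oi := chart_img_open (covX.1 _ AXd); have [_ Kd _ _] := covX.1 _ AXd.
have Phi0 x : Phi (0, x) = 1%g by rewrite /Phi /= F0 mulgV.
have uU (u : 'rV[R]_dX) : chart_img d u -> U ((0 : R^o), u).
  by move=> [x dx <-]; exists (0, x) => //; split => //=; rewrite Phi0.
have Cu : Ck 0 (chart_img d) (fun u : 'rV[R]_dX => ((0 : R^o), u)).
  by apply: Ck_pair => //; [exact: Ck_cst|exact: Ck_id].
apply: (Ck_ext oi _ (Ck_comp oi oU uU Cu (CH ((1 : R^o), 0)).2)) => u du.
by rewrite [LHS]/= -derive_slice_l [RHS]/= /M_ derive1E.
Qed.

End velocity.

(** * Borel sets, continuous functions and integrals *)
Section borel.
Context {R : realType}.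

Lemma borel_open {T : ptopologicalType} (A : set (borel T)) :
  open (A : set T) -> measurable A.
Proof. by move=> oA; exact: sub_sigma_algebra. Qed.

Lemma borel_continuous {S T : ptopologicalType} (f : S -> T) : continuous f ->
  measurable_fun [set: borel S] (f : borel S -> borel T).
Proof.
move=> /continuousP fc.
apply: (@measurability _ _ (borel S) (borel T) _ _ open) => //.
by move=> _ [B oB <-]; rewrite setTI; apply: borel_open; exact: fc.
Qed.

Lemma borel_continuous_real {S : ptopologicalType} (f : S -> R) : continuous f ->
  measurable_fun [set: borel S] (f : borel S -> R).
Proof.
move=> /continuousP fc; apply: (measurability _ (RGenOpens.measurableE R)).
move=> _ [_ [a [b ->] <-]]; rewrite setTI; apply: borel_open.
by apply: fc; exact: interval_open.
Qed.

Lemma compact_continuous_bounded {S : topologicalType} (f : S -> R) :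
  compact [set: S] -> continuous f -> exists M : R, forall x, `|f x| <= M.
Proof.
move=> cS fc.
have : bounded_set (f @` setT : set R^o).
  apply: compact_bounded; apply: continuous_compact => //.
  by apply: continuous_subspaceT.
move=> [M [_ /(_ (M + 1))]]; rewrite ltrDl ltr01 => /(_ isT) bM.
by exists (M + 1) => x; apply: bM; exists x.
Qed.

Lemma bounded_integrable {S : ptopologicalType} (P : probability (borel S) R)
    (f : S -> R) (M : R) :
  measurable_fun [set: borel S] (f : borel S -> R) -> (forall x, `|f x| <= M) ->
  P.-integrable setT (EFin \o f).
Proof.
move=> mf fM; apply: measurable_bounded_integrable => //.
  by apply: le_lt_trans (ltry 1); exact: probability_le1.
exists M; split; first exact: num_real.
by move=> y My x _; apply: le_trans (fM x) _; exact: ltW.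
Qed.

Lemma continuous_integrable {S : ptopologicalType} (P : probability (borel S) R)
    (f : S -> R) : compact [set: S] -> continuous f ->
  P.-integrable setT (EFin \o f).
Proof.
move=> cS fc; have [M fM] := compact_continuous_bounded cS fc.
by apply: (@bounded_integrable _ _ _ M) => //; exact: borel_continuous_real.
Qed.

(** Left invariance of Haar measure will be used in this form. *)
Lemma preserves_integral {T : ptopologicalType} (P : probability (borel T) R)
    (f : T -> T) (u : T -> R) : continuous f -> compact [set: T] -> continuous u ->
  preserves P f -> \int[P]_x u (f x) = \int[P]_x u x.
Proof.
move=> fc cT uc Pf.
have ufc : continuous (u \o f) by move=> x; apply: continuous_comp; [exact: fc|exact: uc].
have mf := borel_continuous fc.
rewrite /Rintegral; congr fine; symmetry.
transitivity (\int[pushforward P (f : borel T -> borel T)]_x (u x)%:E)%E.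
  apply: (eq_measure_integral (pushforward P (f : borel T -> borel T))) => A mA _.
  exact: (esym (Pf A mA)).
rewrite integral_pushforward //.
- by apply/measurable_EFinP; exact: borel_continuous_real.
- by rewrite preimage_setT; exact: continuous_integrable.
Qed.

Section borel_product.
Context {X Y : ptopologicalType}.

Lemma prod_borel_measurable (A : set (X * Y)) :
  (measurable : set (set (borel X * borel Y)%type)) A ->
  (measurable : set (set (borel (X * Y)%type))) A.
Proof.
rewrite measurable_prod_measurableType.
apply: smallest_sub; first exact: sigma_algebra_measurable.
move=> _ [B mB [C mC <-]].
have -> : B `*` C = ((@fst X Y) @^-1` B) `&` ((@snd X Y) @^-1` C) by [].
apply: measurableI; rewrite -[X in measurable X]setTI.
  by apply: (borel_continuous (f := @fst X Y)) => // x; exact: cvg_fst.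
by apply: (borel_continuous (f := @snd X Y)) => // x; exact: cvg_snd.
Qed.

(** An open set of [X * Y] is the union of the countably many products of basic
    open sets that it contains. *)
Lemma borel_prod_measurable (A : set (X * Y)) :
  @second_countable X -> @second_countable Y ->
  (measurable : set (set (borel (X * Y)%type))) A ->
  (measurable : set (set (borel X * borel Y)%type)) A.
Proof.
move=> [B1 cB1 [oB1 bB1]] [B2 cB2 [oB2 bB2]].
suff : open `<=` (measurable : set (set (borel X * borel Y)%type)).
  move=> oM; apply: smallest_sub => //; exact: sigma_algebra_measurable.
move=> U oU.
pose D := (B1 `*` B2) `&` [set b | b.1 `*` b.2 `<=` U].
have cD : countable D.
  apply: (sub_countable (B := B1 `*` B2)); last exact: countableX.
  by apply: subset_card_le => b [].
have -> : U = \bigcup_(b in D) (b.1 `*` b.2).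
  apply/seteqP; split=> [[x y] Uxy|z [b [_ bU] bz]]; last exact: bU.
  have [[P Q] /= [nP nQ] PQU] : nbhs (x, y) U by exact: open_nbhs_nbhs.
  have [V [B1V Vx] VP] := bB1 x _ nP; have [W [B2W Wy] WQ] := bB2 y _ nQ.
  exists (V, W) => //; split => //= z [/VP Pz /WQ Qz]; exact: PQU.
have /countable_injP[f finj] := cD.
have -> : \bigcup_(b in D) (b.1 `*` b.2) =
    \bigcup_k \bigcup_(b in D `&` f @^-1` [set k]) (b.1 `*` b.2).
  apply/seteqP; split=> [z [b Db bz]|z [k _ [b [Db _] bz]]]; last by exists b.
  by exists (f b) => //; exists b.
apply: bigcupT_measurable => k.
have [[b [Db fb]]|D0] := pselect (exists b, (D `&` f @^-1` [set k]) b).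
  rewrite (_ : D `&` _ = [set b]).
    rewrite bigcup_set1; apply: measurableX; apply: borel_open.
      by apply: oB1; case: Db => -[].
    by apply: oB2; case: Db => -[].
  apply/seteqP; split=> [b' [Db' fb']|b' -> //].
  by apply: finj; rewrite ?inE //= fb' fb.
rewrite bigcup0 // => b Db; exfalso; apply: D0; exists b; exact: Db.
Qed.
End borel_product.
End borel.

(** * Unique ergodicity and invariant functions *)
Section null_sets.
Local Open Scope ereal_scope.

Lemma measure_eq_null d (T : measurableType d) (R : realType)
    (m : {measure set T -> \bar R}) (A B N : set T) :
  measurable A -> measurable B -> measurable N -> m N = 0 ->
  (forall z, ~ N z -> A z <-> B z) -> m A = m B.
Proof.
move=> mA mB mN N0 AB; rewrite -(measureU0 mA mN N0) -(measureU0 mB mN N0).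
congr (m _); apply/seteqP; split=> z [Hz|Nz]; try by right.
  by have [Nz|/AB Az] := pselect (N z); [right|left; apply/Az].
by have [Nz|/AB Az] := pselect (N z); [right|left; apply/Az].
Qed.

Lemma null_set_compl d (T : measurableType d) (R : realType) (P : probability T R)
    (N : set T) : P N = 0 -> exists x, ~ N x.
Proof.
move=> N0; apply/not_existsP => NT.
have NE : N = setT by apply/seteqP; split => // x _; exact: contrapT (NT x).
have : P setT = 1 by exact: probability_setT.
by rewrite -NE N0 => /eqP; rewrite eq_sym onee_eq0.
Qed.

End null_sets.

Section unique_ergodicity.
Context {R : realType} {X G : ptopologicalType}.
Context {mX : probability (borel X) R} {mG : probability (borel G) R}.
Hypotheses (scX : @second_countable X) (scG : @second_countable G).
Local Open Scope ereal_scope.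

Let mu : {measure set (borel X * borel G)%type -> \bar R} := mX \x mG.

Lemma product_setT : mu setT = 1.
Proof.
have mXT : mX setT = 1 by exact: probability_setT.
have mGT : mG setT = 1 by exact: probability_setT.
have E := product_measure1E mX mG (@measurableT _ (borel X)) (@measurableT _ (borel G)).
have {}E : mu (setT `*` setT) = mX setT * mG setT by exact: E.
by move: E; rewrite mXT mGT mule1 setXTT.
Qed.

(** The product measure lives on the product of the Borel sigma-algebras, while
    the competitors in [uniquely_ergodic] live on the Borel sigma-algebra of the
    product; second countability makes the restriction a measure on the latter. *)
Lemma restricted_measure (A : set (X * G)) :
  (measurable : set (set (borel X * borel G)%type)) A ->
  exists m : {measure set (borel (X * G)%type) -> \bar R},
    forall B : set (X * G), m B = mu (B `&` A).
Proof.
move=> mA; pose r (B : set (borel (X * G)%type)) := mu ((B : set (X * G)) `&` A).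
have r0 : r set0 = 0 by rewrite /r set0I measure0.
have r_ge0 B : 0 <= r B by exact: measure_ge0.
have r_additive : semi_sigma_additive r.
  move=> B mB tB mUB.
  apply: (@measure_semi_sigma_additive _ _ _ (mrestr mu mA) B) => //.
    by move=> i; exact: borel_prod_measurable.
  exact: borel_prod_measurable.
pose m : {measure set (borel (X * G)%type) -> \bar R} :=
  HB.pack r (isMeasure.Build _ _ _ r r0 r_ge0 r_additive).
by exists m.
Qed.

(** If [A] is invariant up to a null set and has positive measure, then the
    measure conditioned on [A] is invariant, hence equal to [mu]; evaluated at
    [A] this gives [mu A = 1]. *)
Lemma uniquely_ergodic_01 (f : X * G -> X * G) (A N : set (X * G)) :
  continuous f ->
  uniquely_ergodic (mu : set (X * G) -> \bar R) f ->
  (measurable : set (set (borel X * borel G)%type)) A ->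
  (measurable : set (set (borel X * borel G)%type)) N ->
  mu N = 0 -> (forall z, ~ N z -> A (f z) <-> A z) ->
  mu A = 0 \/ mu (~` A) = 0.
Proof.
move=> fc [muf uniq] mA mN N0 Ainv.
have bA := prod_borel_measurable mA.
have [|A0] := eqVneq (mu A) 0; [by left|right].
have muA1 : mu A <= 1 by rewrite -product_setT; apply: le_measure; rewrite ?inE.
have muAfin : mu A \is a fin_num.
  by rewrite ge0_fin_numE ?measure_ge0 //; apply: le_lt_trans muA1 _; rewrite ltry.
have [m mE] := restricted_measure mA.
have mT : m setT = mu A by rewrite mE setTI.
pose nu : probability (borel (X * G)%type) R :=
  mnormalize m (dirac (point : borel (X * G)%type)).
have nuE B : nu B = mu (B `&` A) * (fine (mu A))^-1%:E.
  rewrite /nu /= /mnormalize mT (negbTE A0) /= (_ : (mu A == +oo) = false) ?mE //.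
  by apply/negbTE; move: muAfin; rewrite fin_numE => /andP[].
have mfpre B : (measurable : set (set (borel (X * G)%type))) B ->
    (measurable : set (set (borel X * borel G)%type)) (f @^-1` B).
  move=> mB; apply: borel_prod_measurable => //.
  by rewrite -[X in measurable X]setTI; exact: (borel_continuous fc).
have nuf : preserves nu f.
  move=> B mB; have mB' := borel_prod_measurable scX scG mB.
  have bBA : (measurable : set (set (borel (X * G)%type))) (B `&` A) by exact: measurableI.
  rewrite !nuE; congr (_ * _).
  rewrite -(muf _ bBA); apply: (measure_eq_null _ _ mN N0).
  - by apply: measurableI => //; exact: mfpre.
  - exact: mfpre.
  - by move=> z Nz; split => -[Bz] /(Ainv z Nz) Az; split.
have nuA : mu A = 1.
  rewrite -(uniq nu nuf A bA) nuE setIid -{1}(fineK muAfin) -EFinM divff //.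
  by rewrite fine_eq0.
have : mu (A `|` ~` A) = mu A + mu (~` A).
  by apply: measureU => //; [exact: measurableC|rewrite setICr].
rewrite setUCr product_setT nuA => /esym/eqP.
have mAc := measurableC mA.
have : mu (~` A) \is a fin_num.
  rewrite ge0_fin_numE ?measure_ge0 //; apply: (@le_lt_trans _ _ 1); last by rewrite ltry.
  by rewrite -product_setT; apply: le_measure; rewrite ?inE.
move=> /fineK <-; rewrite -EFinD eqe => /eqP E; congr (_%:E).
by apply: (addrI 1%R); rewrite addr0.
Qed.

(** Each set [h < q] with [q] rational is null or conull.  Off the union of the
    null ones and of the complements of the others, two distinct values of [h]
    would be separated by some [q]. *)
Lemma invariant_ae_constant (f : X * G -> X * G) (h : X * G -> R) (N : set (X * G)) :
  continuous f ->
  uniquely_ergodic (mu : set (X * G) -> \bar R) f ->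
  measurable_fun [set: (borel X * borel G)%type] (h : (borel X * borel G)%type -> R) ->
  (measurable : set (set (borel X * borel G)%type)) N ->
  mu N = 0 -> (forall z, ~ N z -> h (f z) = h z) ->
  exists N' : set (X * G), mu.-negligible N' /\
    forall z z', ~ N' z -> ~ N' z' -> h z = h z'.
Proof.
move=> fc ue mh mN N0 hinv.
pose S (q : rat) := [set z : X * G | (h z < ratr q)%R].
have mS q : (measurable : set (set (borel X * borel G)%type)) (S q).
  rewrite -[X in measurable X]setTI.
  have -> : S q = h @^-1` `]-oo, (ratr q)[%classic.
    by apply/seteqP; split=> z; rewrite /S /= in_itv.
  by apply: mh => //; exact: measurable_itv.
have S01 q : mu (S q) = 0 \/ mu (~` S q) = 0.
  by apply: (uniquely_ergodic_01 fc ue _ mN N0) => // z Nz; rewrite /S /= hinv.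
pose B q := if pselect (mu (S q) = 0) then S q else ~` S q.
have B0 q : mu.-negligible (B q).
  rewrite /B; case: pselect => [S0|S0]; first exact/negligibleP.
  by apply/negligibleP; [exact: measurableC|case: (S01 q)].
(* the rationals enumerated through their encoding in nat *)
exists (\bigcup_k (if unpickle k is Some q then B q else set0)); split.
  apply: negligible_bigcup => k; case: unpickle => [q|]; first exact: B0.
  exact: negligible_set0.
have key z z' : ~ (\bigcup_k (if unpickle k is Some q then B q else set0)) z ->
    ~ (\bigcup_k (if unpickle k is Some q then B q else set0)) z' -> (h z <= h z')%R.
  move=> Nz Nz'; rewrite leNgt; apply/negP => /rat_in_itvoo[q].
  rewrite in_itv /= => /andP[h1 h2].
  have notB w : ~ (\bigcup_k (if unpickle k is Some q then B q else set0)) w -> ~ B q w.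
    by apply: contra_not => Bw; exists (pickle q); [exact: I|rewrite pickleK; exact: Bw].
  have := notB _ Nz; have := notB _ Nz'; rewrite /B; case: pselect => muS0.
    by move=> /(_ h1).
  by move=> _; apply; apply/negP; rewrite -leNgt ltW.
by move=> z z' Nz Nz'; apply/eqP; rewrite eq_le !key.
Qed.

Lemma product_null_section (N : set (X * G)) : mu.-negligible N ->
  {ae mX, forall x, mG.-negligible [set g | N (x, g)]}.
Proof.
move=> [M [mM M0 NM]].
have mfM := measurable_fun_xsection mG mM.
have : ae_eq mX setT (mG \o xsection M) (cst 0).
  apply/(ae_eq_integral_abs mX measurableT mfM).
  rewrite -[RHS]M0; apply: eq_integral => x _.
  by rewrite gee0_abs // measure_ge0.
apply: filterS => x /(_ I) /= Mx0.
exists (xsection M x); split => //; first exact: measurable_xsection.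
by move=> g /NM; rewrite /xsection /= inE.
Qed.

End unique_ergodicity.

(** * Integrals of vector valued functions *)
Section vector_integrals.
Context {R : realType} {T : ptopologicalType} {P : probability (borel T) R}.

Lemma Rintegral_lincomb (I : Type) (s : seq I) (a : I -> R) (f : I -> T -> R) :
  (forall i, P.-integrable setT (EFin \o f i)) ->
  P.-integrable setT (EFin \o (fun x => \sum_(i <- s) a i * f i x)) /\
  \int[P]_x (\sum_(i <- s) a i * f i x) = \sum_(i <- s) a i * \int[P]_x f i x.
Proof.
move=> fint; elim: s => [|i s [IHi IHe]].
  have -> : (fun x => \sum_(i <- [::]) a i * f i x) = (fun=> 0 : R).
    by apply/funext => x; rewrite big_nil.
  split; first exact: integrable0.
  by rewrite Rintegral_cst // mul0r big_nil.
have -> : (fun x => \sum_(j <- i :: s) a j * f j x) =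
    (fun x => a i * f i x + \sum_(j <- s) a j * f j x).
  by apply/funext => x; rewrite big_cons.
have aint : P.-integrable setT (EFin \o (fun x => a i * f i x)).
  by apply: (integrableZl measurableT (a i) (fint i)).
split; first exact: (integrableD measurableT aint IHi).
by rewrite RintegralD // RintegralZl // IHe big_cons.
Qed.

Lemma Rintegral_prob_cst (r : R) : \int[P]_x r = r.
Proof.
have E : P setT = 1%E by exact: probability_setT.
have := @Rintegral_cst _ _ _ P setT measurableT r.
by move=> ->; rewrite -[RHS]mulr1; congr (_ * _); rewrite -[RHS]/(fine 1%:E); congr fine; exact: E.
Qed.

Lemma integral_rV_linear n (f : T -> 'rV[R]_n) (L : 'rV[R]_n -> R) :
  (forall j, P.-integrable setT (EFin \o (fun x => f x 0 j))) ->
  scalar L -> \int[P]_x L (f x) = L (integral_rV P f).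
Proof.
move=> fint Llin.
pose L' : {linear 'rV[R]_n -> R^o} :=
  HB.pack L (GRing.isLinear.Build R 'rV[R]_n R^o *:%R L Llin).
have LE v : L v = \sum_i L (delta_mx 0 i) * v 0 i.
  rewrite {1}(row_sum_delta v) -[LHS]/(L' _) linear_sum.
  by apply: eq_bigr => i _; rewrite linearZ /= mulrC.
rewrite [RHS]LE.
have [_ E] := Rintegral_lincomb (index_enum 'I_n) (fun i => L (delta_mx 0 i)) fint.
have -> : (fun x => L (f x)) = (fun x => \sum_i L (delta_mx 0 i) * f x 0 i).
  by apply/funext => x; exact: LE.
by rewrite E; apply: eq_bigr => i _; rewrite mxE.
Qed.

End vector_integrals.

Section borel_coordinates.
Context {R : realType} {T : ptopologicalType} {n : nat}.

Lemma coord_borel (f : T -> 'rV[R]_n) j :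
  measurable_fun [set: borel T] (f : borel T -> borel 'rV[R]_n) ->
  measurable_fun [set: borel T] (fun x : borel T => f x 0 j).
Proof.
move=> mf.
have mc : measurable_fun [set: borel 'rV[R]_n] (fun v : borel 'rV[R]_n => v 0 j).
  by apply: borel_continuous_real; exact: coord_continuous.
exact: (measurableT_comp mc mf).
Qed.

Lemma coord_continuousT {S : topologicalType} (f : S -> 'rV[R]_n) j : continuous f ->
  continuous (fun x => f x 0 j : R).
Proof.
move=> fc x; apply: (cvg_comp f (fun v : 'rV[R]_n => v 0 j : R)); [exact: fc|].
exact: coord_continuous.
Qed.

End borel_coordinates.

Section dot_products.
Context {R : realType} {n : nat} (ip : {dot 'rV[R]_n for idfun}).

Lemma ip_scalarl v : scalar (fun u => ip u v).
Proof. by move=> a u w; rewrite linearPl. Qed.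

Lemma ip_expand u v :
  ip u v = \sum_i \sum_j u 0 i * (v 0 j * ip (delta_mx 0 i) (delta_mx 0 j)).
Proof.
rewrite {1}(row_sum_delta u) linear_sumlz; apply: eq_bigr => i _.
rewrite linearZl_LR {1}(row_sum_delta v) linear_sumr /= -mulr_sumr; congr (_ * _).
by apply: eq_bigr => j _; rewrite linearZr_LR.
Qed.

Lemma ip_eq0 u : ip u u = 0 -> u = 0.
Proof.
move=> u0; apply/eqP; apply: contraT => /(@neq0_dnorm_gt0 _ _ _ ip) u_gt0.
by have : 0 < ip u u by []; rewrite u0 ltxx.
Qed.

Lemma ip_measurable d (T : measurableType d) (f g : T -> 'rV[R]_n) :
  (forall j, measurable_fun setT (fun x => f x 0 j)) ->
  (forall j, measurable_fun setT (fun x => g x 0 j)) ->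
  measurable_fun setT (fun x => ip (f x) (g x)).
Proof.
move=> mf mg.
rewrite (_ : (fun x => _) = (fun x => \sum_i \sum_j
    f x 0 i * (g x 0 j * ip (delta_mx 0 i) (delta_mx 0 j)))); last first.
  by apply/funext => x; exact: ip_expand.
apply: measurable_sum => i; apply: measurable_sum => j.
by apply: measurable_funM => //; apply: measurable_funM.
Qed.

Lemma ip_continuous (T : topologicalType) (f g : T -> 'rV[R]_n) :
  continuous f -> continuous g -> continuous (fun x => ip (f x) (g x) : R).
Proof.
move=> fc gc.
rewrite (_ : (fun x => _) = (fun x => \sum_i \sum_j
    f x 0 i * (g x 0 j * ip (delta_mx 0 i) (delta_mx 0 j)))); last first.
  by apply/funext => x; exact: ip_expand.
apply: continuous_big => [|i _]; first exact: add_continuous.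
apply: continuous_big => [|j _]; first exact: add_continuous.
move=> x; apply: cvgM; first exact: coord_continuousT.
by apply: cvgMr_tmp; exact: coord_continuousT.
Qed.

End dot_products.

(** * The kernel of [1 - W_phi] *)
Section invariant_functions.
Context {R : realType} {X : ptopologicalType} {G : ptopGroupType} {n : nat}.
Context {mX : probability (borel X) R} {mG : probability (borel G) R}.
Context {AG : set (chart G 'rV[R]_n)} {c : chart G 'rV[R]_n}.
Context {F : R -> X -> X} {phi : X -> G} {ip : {dot 'rV[R]_n for idfun}}.
Hypotheses (scX : @second_countable X) (G_lie : compact_lie_group AG)
  (mG_haar : haar mG) (AGc : AG c) (c1 : cdom c 1%g)
  (F1c : continuous (F 1)) (phic : continuous phi)
  (ue : uniquely_ergodic ((mX \x mG)%E : set (X * G) -> \bar R) (skew_product F phi)).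

Lemma compactG : compact [set: G].
Proof. by case: G_lie => -[]. Qed.

Lemma second_countableG : @second_countable G.
Proof. by case: G_lie => -[]. Qed.

Lemma skew_product_continuous : continuous (skew_product F phi).
Proof.
move=> p; apply: cvg_pair => /=.
  by apply: (cvg_comp fst (F 1)); [exact: cvg_fst|exact: F1c].
have [mc _] := mul_Ck G_lie 0.
have pc : (fun q : X * G => (q.2, phi q.1)) @ p --> (p.2, phi p.1).
  apply: cvg_pair; first exact: cvg_snd.
  by apply: (cvg_comp fst phi); [exact: cvg_fst|exact: phic].
exact: (cvg_comp _ _ pc (mc (p.2, phi p.1))).
Qed.

Lemma Ad_expand g (v : 'rV[R]_n) j :
  Ad c g v 0 j = \sum_i v 0 i * Ad c g (delta_mx 0 i) 0 j.
Proof.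
pose L : {linear 'rV[R]_n -> 'rV[R]_n} :=
  HB.pack (Ad c g) (GRing.isLinear.Build R _ _ _ (Ad c g) (Ad_linear G_lie AGc c1 g)).
rewrite {1}(row_sum_delta v) -[Ad c g _]/(L _) linear_sum summxE.
by apply: eq_bigr => i _; rewrite linearZ mxE.
Qed.

Lemma Ad_measurable (f : X -> 'rV[R]_n) j :
  measurable_fun [set: borel X] (f : borel X -> borel 'rV[R]_n) ->
  measurable_fun [set: (borel X * borel G)%type]
    (fun z : borel X * borel G => Ad c z.2 (f z.1) 0 j).
Proof.
move=> mf.
rewrite (_ : (fun z => _) = (fun z : borel X * borel G =>
   \sum_i f z.1 0 i * Ad c z.2 (delta_mx 0 i) 0 j)); last first.
  by apply/funext => z; exact: Ad_expand.
apply: measurable_sum => i; apply: measurable_funM.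
  exact: (measurableT_comp (coord_borel i mf) (@measurable_fst _ _ (borel X) (borel G))).
have mAd : measurable_fun [set: borel G] (fun g : borel G => Ad c g (delta_mx 0 i) 0 j).
  apply: borel_continuous_real; apply: coord_continuousT.
  exact: (Ad_continuous G_lie AGc c1).
exact: (measurableT_comp mAd (@measurable_snd _ _ (borel X) (borel G))).
Qed.

(** [Ad_g f(x)] is invariant under [T_phi], hence equal to a constant [Z] for
    almost every [(x, g)].  For almost every [x] this holds for almost every
    [g]; given [k], left invariance of Haar measure provides a [g] such that it
    holds at both [g] and [k g], whence [Ad_k Z = Z], and then [f(x) = Z]. *)
Lemma ker_ae_constant (f : X -> 'rV[R]_n) : ker_1subW F c phi mX ip f ->
  exists2 Z, Ad_fixed c Z & {ae mX, forall x, f x = Z}.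
Proof.
move=> [[mf _] [N [mN N0 Wf]]].
pose h j (z : X * G) := Ad c z.2 (f z.1) 0 j.
pose NG : set (X * G) := N `*` setT.
have mNG : (measurable : set (set (borel X * borel G)%type)) NG by exact: measurableX.
pose mu : {measure set (borel X * borel G)%type -> \bar R} := (mX \x mG)%E.
have NG0 : mu NG = 0%E.
  have E := product_measure1E mX mG mN (@measurableT _ (borel G)).
  have {}E : mu NG = (mX N * mG setT)%E by exact: E.
  by rewrite E N0 mul0e.
have hinv j z : ~ NG z -> h j (skew_product F phi z) = h j z.
  move: z => [x g] Nz; rewrite /h /= (Ad_mul G_lie AGc c1); congr (Ad c g _ _ _).
  by apply: contrapT => Wx; apply: Nz; split => //; apply: Wf.
have /choice[N' N'P] (j : 'I_n) := invariant_ae_constant scX second_countableG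
  skew_product_continuous ue (Ad_measurable j mf) mNG NG0 (hinv j).
pose M := \bigcup_k (if insub k is Some j then N' j else set0).
have M0 : mu.-negligible M.
  apply: negligible_bigcup => k; case: insub => [j|]; first exact: (N'P j).1.
  exact: negligible_set0.
have hM z z' : ~ M z -> ~ M z' -> Ad c z.2 (f z.1) = Ad c z'.2 (f z'.1).
  have notN' w j : ~ M w -> ~ N' j w.
    by apply: contra_not => Nw; exists (val j); [exact: I|rewrite valK].
  by move=> Mz Mz'; apply/rowP => j; apply: (N'P j).2; exact: notN'.
have [D [mD D0 DP]] := product_null_section M0.
have [x0 Dx0] := null_set_compl D0.
have secP x : ~ D x -> mG.-negligible [set g | M (x, g)].
  by move=> Dx; apply: contrapT => H; apply: Dx; exact: DP.
have [g0 Mg0] : exists g0, ~ M (x0, g0).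
  have [E [mE E0 EP]] := secP _ Dx0; have [g Eg] := null_set_compl E0.
  by exists g; apply: contra_not Eg => Mg; exact: EP.
pose Z := Ad c g0 (f x0).
have ZP x : ~ D x -> f x = Z /\ Ad_fixed c Z.
  move=> Dx; have [E [mE E0 EP]] := secP _ Dx.
  have AdE g : ~ E g -> Ad c g (f x) = Z.
    move=> Eg; apply: (hM (x, g) (x0, g0)) => //.
    by apply: contra_not Eg => Mg; exact: EP.
  have fixZ : Ad_fixed c Z.
    move=> k; pose E' := [set g : G | E (k * g)%g].
    have mE' : measurable (E' : set (borel G)).
      rewrite -[X in measurable X]setTI.
      exact: (borel_continuous (mulg_continuous G_lie (g := k))).
    have E'0 : mG E' = 0%E by have := mG_haar k mE; rewrite E0.
    have EE'0 : mG (E `|` E') = 0%E.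
      by apply: (etrans (measureU0 mE mE' E'0)).
    have [g Eg] := null_set_compl EE'0.
    have nE : ~ E g by apply: contra_not Eg; left.
    have nE' : ~ E (k * g)%g by apply: contra_not Eg; right.
    by rewrite -{1}(AdE _ nE) -(Ad_mul G_lie AGc c1) AdE.
  split=> //; have [g Eg] := null_set_compl E0.
  by rewrite -[LHS](AdK G_lie AGc c1 g) AdE.
exists Z; first exact: (ZP x0 Dx0).2.
exists D; split => // x fx; apply: contrapT => Dx; apply: fx; exact: (ZP x Dx).1.
Qed.

End invariant_functions.

(** * The degree as a Haar average *)
Section haar_average.
Context {R : realType} {G : ptopGroupType} {n : nat}.
Context {mG : probability (borel G) R}.
Context {AG : set (chart G 'rV[R]_n)} {c : chart G 'rV[R]_n}.
Context {ip : {dot 'rV[R]_n for idfun}}.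
Hypotheses (G_lie : compact_lie_group AG) (mG_haar : haar mG)
  (AGc : AG c) (c1 : cdom c 1%g) (ip_inv : Ad_invariant c ip).

Lemma Ad_integrable Z j : mG.-integrable setT (EFin \o (fun g => Ad c g Z 0 j)).
Proof.
apply: continuous_integrable; first exact: (compactG G_lie).
by apply: coord_continuousT; exact: (Ad_continuous G_lie AGc c1).
Qed.

Lemma P_Ad_fixed Z : Ad_fixed c (P_Ad c mG Z).
Proof.
move=> h; apply/rowP => j.
have Lh : scalar (fun v => Ad c h v 0 j).
  by move=> a u v; rewrite (Ad_linear G_lie AGc c1) !mxE.
rewrite -[LHS](integral_rV_linear (fun j => Ad_integrable Z j) Lh).
have uc : continuous (fun g => Ad c g Z 0 j : R).
  by apply: coord_continuousT; exact: (Ad_continuous G_lie AGc c1).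
have E := preserves_integral (mulg_continuous G_lie (g := h)) (compactG G_lie) uc (mG_haar h).
rewrite [RHS]mxE; apply: etrans E; congr Rintegral.
by apply/funext => g; rewrite (Ad_mul G_lie AGc c1).
Qed.

(** For [Ad]-fixed [Z], invariance of the scalar product makes
    [ip (Ad_g V) Z = ip (Ad_g V) (Ad_g Z)] independent of [g]. *)
Lemma P_Ad_orthogonal V Z : Ad_fixed c Z -> ip (P_Ad c mG V) Z = ip V Z.
Proof.
move=> fixZ.
rewrite -[LHS](integral_rV_linear (fun j => Ad_integrable V j) (ip_scalarl ip Z)).
rewrite -[RHS](Rintegral_prob_cst (P := mG)); congr Rintegral.
by apply/funext => g; rewrite -{1}(fixZ g) ip_inv.
Qed.

Lemma Ad_fixed_scalar a Z : Ad_fixed c Z -> Ad_fixed c (a *: Z).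
Proof.
move=> fixZ g; have := Ad_linear G_lie AGc c1 g a Z 0.
have Ad0 : Ad c g 0 = 0.
  by have := Ad_linear G_lie AGc c1 g (-1) 0 0; rewrite scaler0 addr0 scaleN1r addNr.
by rewrite !addr0 Ad0 addr0 fixZ.
Qed.

Lemma Ad_fixedB Z W : Ad_fixed c Z -> Ad_fixed c W -> Ad_fixed c (Z - W).
Proof.
move=> fixZ fixW g; rewrite addrC -scaleN1r (Ad_linear G_lie AGc c1).
by rewrite fixZ fixW.
Qed.

End haar_average.

Section degree.
Context {R : realType} {X : ptopologicalType} {dX : nat}.
Context {AX : set (chart X 'rV[R]_dX)} {mX : probability (borel X) R}.
Context {F : R -> X -> X} {G : ptopGroupType} {n : nat}.
Context {mG : probability (borel G) R}.
Context {AG : set (chart G 'rV[R]_n)} {c : chart G 'rV[R]_n}.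
Context {ip : {dot 'rV[R]_n for idfun}} {phi : X -> G}.
Hypotheses (X_manifold : compact_manifold AX) (F_flow : C1_flow AX F)
  (G_lie : compact_lie_group AG) (mG_haar : haar mG)
  (AGc : AG c) (c1 : cdom c 1%g) (ip_inv : Ad_invariant c ip)
  (C1phi : Ck_map 1 AX AG phi)
  (ue : uniquely_ergodic ((mX \x mG)%E : set (X * G) -> \bar R) (skew_product F phi)).

Let smX : smooth_atlas AX. Proof. by case: X_manifold. Qed.
Let compactX : compact [set: X]. Proof. by case: X_manifold. Qed.
Let scX : @second_countable X. Proof. by case: X_manifold. Qed.
Let phic : continuous phi. Proof. by case: C1phi. Qed.
Let Mc : continuous (M_ F c phi).
Proof. exact: (M_continuous smX F_flow G_lie AGc c1 C1phi). Qed.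
Let F1c : continuous (F 1).
Proof.
have [_ _ [Fc _]] := F_flow => x.
have pc : (fun y : X => ((1 : R), y)) @ x --> ((1 : R), x).
  exact: (cvg_pair (cvg_cst (1 : R)) cvg_id).
exact: (cvg_comp _ _ pc (Fc (1, x))).
Qed.
Let Mint j : mX.-integrable setT (EFin \o (fun x => M_ F c phi x 0 j)).
Proof. by apply: continuous_integrable => //; exact: coord_continuousT. Qed.

Let Mstar := M_star F c phi mX mG.

Lemma Mstar_fixed : Ad_fixed c Mstar.
Proof. exact: (P_Ad_fixed G_lie mG_haar AGc c1). Qed.

Lemma L2_M : L2 mX ip (M_ F c phi).
Proof.
split; first exact: borel_continuous.
apply: integrable_lty => //; apply: continuous_integrable => //.
exact: ip_continuous.
Qed.

Lemma ker_cst Z : Ad_fixed c Z -> ker_1subW F c phi mX ip (fun=> Z).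
Proof.
move=> fixZ; split; last by apply: aeW => x; exact: fixZ.
split; first exact: measurable_cst.
apply: integrable_lty => //; apply: continuous_integrable => // x; exact: cvg_cst.
Qed.

(** Applied with [p] constantly equal to [Mstar] it gives the orthogonality
    that characterises the projection; applied to any representative [p] of the
    degree, with [h] the constant [Mstar - Z], it gives uniqueness. *)
Lemma integral_ip_ker (p h : X -> 'rV[R]_n) Z W :
  measurable_fun [set: borel X] (p : borel X -> borel 'rV[R]_n) ->
  measurable_fun [set: borel X] (h : borel X -> borel 'rV[R]_n) ->
  {ae mX, forall x, p x = Z} -> {ae mX, forall x, h x = W} -> Ad_fixed c W ->
  \int[mX]_x ip (M_ F c phi x - p x) (h x) = ip (Mstar - Z) W.
Proof.
move=> mp mh pZ hW fixW.
have mM := borel_continuous Mc.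
have mMp j : measurable_fun [set: borel X] (fun x : borel X => (M_ F c phi x - p x) 0 j).
  rewrite (_ : (fun x => _) = (fun x => M_ F c phi x 0 j - p x 0 j)).
    by apply: measurable_funB; exact: coord_borel.
  by apply/funext => x; rewrite !mxE.
have mMZ j : measurable_fun [set: borel X] (fun x : borel X => (M_ F c phi x - Z) 0 j).
  rewrite (_ : (fun x => _) = (fun x => M_ F c phi x 0 j - Z 0 j)).
    by apply: measurable_funB; [exact: coord_borel|exact: measurable_cst].
  by apply/funext => x; rewrite !mxE.
transitivity (\int[mX]_x ip (M_ F c phi x - Z) W).
  rewrite /Rintegral; congr fine; apply: ae_eq_integral => //.
  - apply/measurable_EFinP; apply: ip_measurable => // j; exact: coord_borel.
  - apply/measurable_EFinP; apply: ip_measurable => // j; exact: measurable_cst.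
  - by move: pZ hW; apply: (@filterS2 _ (almost_everywhere mX) (ae_filter_ringOfSetsType mX)) => x -> -> _.
have E x : ip (M_ F c phi x - Z) W = ip (M_ F c phi x) W - ip Z W by rewrite linearBl.
under eq_Rintegral do rewrite E.
have ipint : mX.-integrable setT (EFin \o (fun x => ip (M_ F c phi x) W)).
  apply: continuous_integrable => //; apply: ip_continuous => // x; exact: cvg_cst.
rewrite RintegralB //; last first.
  by apply: continuous_integrable => // x; exact: cvg_cst.
rewrite (integral_rV_linear Mint (ip_scalarl ip W)) Rintegral_prob_cst.
by rewrite -(P_Ad_orthogonal (mG := mG) G_lie AGc c1 ip_inv _ fixW) linearBl.
Qed.

Lemma degree_Mstar : is_degree F c phi mX ip (fun=> Mstar).
Proof.
split; [exact: L2_M|exact: (ker_cst Mstar_fixed)|move=> h Kh].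
have [W fixW hW] := ker_ae_constant scX G_lie mG_haar AGc c1 F1c phic ue Kh.
have [[mh _] _] := Kh.
rewrite (integral_ip_ker (measurable_cst _) mh (aeW _ (fun=> erefl)) hW fixW).
by rewrite subrr linear0l.
Qed.

Lemma degree_unique p : is_degree F c phi mX ip p -> {ae mX, forall x, p x = Mstar}.
Proof.
move=> [_ Kp porth].
have [Z fixZ pZ] := ker_ae_constant scX G_lie mG_haar AGc c1 F1c phic ue Kp.
have [[mp _] _] := Kp.
have fixB := Ad_fixedB G_lie AGc c1 Mstar_fixed fixZ.
have := porth _ (ker_cst fixB).
rewrite (integral_ip_ker mp (measurable_cst _) pZ (aeW _ (fun=> erefl)) fixB).
by move=> /ip_eq0/eqP; rewrite subr_eq0 => /eqP ->.
Qed.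

End degree.

(** * Bump functions on a Lie group *)
Section bump.
Context {R : realType}.

(** A C^1 function on the line vanishing exactly on the nonpositive numbers. *)
Definition sqrpos (s : R^o) : R^o := Num.max 0 s ^+ 2.

Lemma sqrpos_taylor (s h : R) :
  `|sqrpos (s + h) - sqrpos s - Num.max 0 s * 2 * h| <= h ^+ 2.
Proof.
rewrite /sqrpos; have [s0|s0] := leP 0 s; have [sh|sh] := leP 0 (s + h).
- by rewrite ler_norml; apply/andP; split; nra.
- by rewrite ler_norml; apply/andP; split; nra.
- by rewrite ler_norml; apply/andP; split; nra.
- by rewrite ler_norml; apply/andP; split; nra.
Qed.

Lemma is_derive_sqrpos (s : R^o) : is_derive s (1 : R^o) sqrpos (Num.max 0 s * 2).
Proof.
have dcvg : (fun h : R => h^-1 *: ((sqrpos \o shift s) (h *: (1 : R^o)) - sqrpos s))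
    @ 0^' --> (Num.max 0 s * 2 : R^o).
  apply/cvgrPdist_le => /= e e0; exists e => // h /=; rewrite sub0r normrN => he h0.
  rewrite distrC /= [_%:A]mulr1 [h + s]addrC.
  have -> : h^-1 *: (sqrpos (s + h) - sqrpos s) - Num.max 0 s * 2 =
      h^-1 * (sqrpos (s + h) - sqrpos s - Num.max 0 s * 2 * h).
    by rewrite [RHS]mulrBr [X in _ = _ - X]mulrC mulfK.
  rewrite normrM normfV ler_pdivrMl ?normr_gt0 //.
  apply: le_trans (sqrpos_taylor s h) _.
  by rewrite -(real_normK (num_real h)) expr2 ler_wpM2l // ltW.
split; first by apply/cvg_ex; eexists; exact: dcvg.
exact: cvg_lim dcvg.
Qed.

Lemma C1_sqrpos : Ck 1 setT sqrpos.
Proof.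
move=> v; have dv s : is_derive s v sqrpos (v *: (Num.max 0 s * 2 : R^o)).
  have [d1 E] := is_derive_sqrpos s.
  have E1 : v *: (1 : R^o) = v by exact: mulr1.
  by have := is_deriveZ_dir v d1; rewrite E E1.
split=> [s _|s _]; first by have [] := dv s.
have -> : 'D_v sqrpos = (fun s => v *: (Num.max 0 s * 2 : R^o)).
  by apply/funext => t; have [_ ->] := dv t.
apply: cvgZl_tmp; apply: cvgMr_tmp.
apply: continuous_max; first exact: cvg_cst; exact: cvg_id.
Qed.

(** The square of the euclidean distance, which, unlike the sup norm of row
    vectors, is smooth. *)
Definition sqdist n (a v : 'rV[R]_n) : R^o := \sum_i ((v - a) 0 i * (v - a) 0 i).

Lemma Ck_sqdist k n (a : 'rV[R]_n) : Ck k setT (sqdist a).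
Proof.
have Cc i : Ck k setT (fun v : 'rV[R]_n => (v - a) 0 i : R^o).
  have CB : Ck k setT ((id : 'rV[R]_n -> 'rV[R]_n) + (fun=> - a)).
    by apply: CkD; [exact: openT|exact: Ck_id|exact: Ck_cst].
  apply: (Ck_lin (L := @rV_coord R n i) openT _ CB).
  by move=> x; exact: coord_continuous.
by apply: Ck_sum => [|i]; [exact: openT|apply: CkM => //; exact: openT].
Qed.

Lemma sqdist_ball n (a v : 'rV[R]_n) (r : R) : 0 < r -> sqdist a v < r ^+ 2 ->
  `|v - a| <= r.
Proof.
move=> r0 vr; have jr j : `|(v - a) 0 j| <= r.
  rewrite real_ler_norml ?num_real //.
  have : (v - a) 0 j ^+ 2 <= r ^+ 2.
    apply: le_trans (ltW vr); rewrite /sqdist (bigD1 j) //= -expr2 lerDl.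
    by apply: sumr_ge0 => k _; rewrite -expr2 sqr_ge0.
  by move=> h; apply/andP; split; nra.
rewrite /Num.Def.normr /= mx_normrE.
by apply: (bigmax_le _ (ltW r0)) => -[i j] _ /=; rewrite ord1.
Qed.

Context {G : ptopGroupType} {n : nat} {AG : set (chart G 'rV[R]_n)}.
Context {c : chart G 'rV[R]_n}.
Hypotheses (G_lie : compact_lie_group AG) (AGc : AG c) (c1 : cdom c 1%g).

Let covG := smooth_covering (lie_smooth G_lie).

(** In the chart [c], take [sqrpos (rho^2 - |v - a|^2)], and extend it by 0.  The
    extension is C^1 because its support lies in the image [K] of a closed ball,
    which is compact, hence closed in [G]. *)
Lemma smooth_bump (V : set G) : nbhs 1%g V ->
  exists psi : G -> R^o, [/\ Ck_map 1 AG (flat_atlas R^o) psi,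
    forall g, 0 <= psi g, 0 < psi 1%g & forall g, psi g != 0 -> V g].
Proof.
move=> nV; pose a := cmap c 1%g.
have [[oc oi] Kc cmc cic] := covG.1 c AGc.
have aimg : chart_img c a by exists 1%g.
have [r r0 rV] : exists2 r : R, 0 < r &
    ball a r `<=` [set v | chart_img c v /\ V (cinv c v)].
  apply/nbhs_ballP; apply: filterI; first exact: open_nbhs_nbhs.
  by apply: cic => //; rewrite Kc.
pose rho := r / 2.
have rho0 : 0 < rho by rewrite divr_gt0.
have rhor : rho < r by rewrite ltr_pdivrMr // ltr_pMr // ltr1n.
pose B := [set v : 'rV[R]_n | `|v - a| <= rho].
have Bball : B `<=` ball a r.
  by move=> v /=; rewrite -ball_normE /= distrC => /le_lt_trans; exact.
pose K := cinv c @` B.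
have Bcl : closed B.
  have -> : B = closed_ball a rho.
    by rewrite closed_ballE //; apply/seteqP; split=> v; rewrite /B /closed_ball_ /= distrC.
  exact: closed_ball_closed.
have Bcompact : compact B.
  apply: bounded_closed_compact => //.
  exists (`|a| + rho); split; first exact: num_real.
  move=> M aM v Bv; apply: ltW; apply: le_lt_trans aM.
  by rewrite -[v](subrK a) addrC; apply: le_trans (ler_normD _ _) _; rewrite lerD2l.
have Kcl : closed K.
  apply: compact_closed; first by case: G_lie => -[].
  apply: continuous_compact => //; apply: continuous_in_subspaceT => v.
  by rewrite inE => /Bball /rV[iv _]; exact: cic.
pose eta (v : 'rV[R]_n) : R^o := sqrpos (rho ^+ 2 - sqdist a v).
have Ceta : Ck 1 setT eta.
  have Cin : Ck 1 setT (fun v => rho ^+ 2 - sqdist a v : R^o).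
    have CN : Ck 1 setT (fun v => -1 * sqdist a v : R^o).
      by apply: CkM; [exact: openT|exact: Ck_cst|exact: Ck_sqdist].
    have CD := CkD openT (Ck_cst 1 setT (rho ^+ 2 : R^o)) CN.
    by apply: (Ck_ext openT _ CD) => v _; rewrite -[LHS]/(_ + _) mulN1r.
  exact: (Ck_comp openT openT _ Cin C1_sqrpos).
have eta0 v : eta v != 0 -> B v.
  rewrite /eta /sqrpos => e0; apply: sqdist_ball => //.
  rewrite -subr_gt0 ltNge; apply: contra e0 => e0.
  by rewrite (max_idPl e0) expr0n.
pose psi g : R^o := if pselect (cdom c g) then eta (cmap c g) else 0.
have psiK g : ~ K g -> psi g = 0.
  rewrite /psi; case: pselect => // cg; apply: contra_notP => /eqP /eta0 Bg.
  by exists (cmap c g) => //; exact: Kc.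
exists psi; split.
- apply: (Ck_map_flat covG) => d AGd; have [[od odi] Kd cmd cid] := covG.1 d AGd.
  apply: Ck_local => _ [g dg <-]; have [cg|ncg] := pselect (cdom c g).
    exists (cmap d @` (cdom d `&` cdom c)); first by exists g.
    have oO : open (cmap d @` (cdom d `&` cdom c)).
      by apply: chart_image_open => //; exact: covG.1.
    have [_ _ /(_ d c 1 AGd AGc) Cdc] := lie_smooth G_lie.
    apply: (Ck_ext oO _ (Ck_comp oO openT _ Cdc Ceta)) => //.
    by move=> _ [h [dh ch] <-]; rewrite /psi /= Kd //; case: pselect.
  have nKg : ~ K g.
    move=> [v Bv vg]; apply: ncg; rewrite -vg.
    by have [iv _] := rV _ (Bball _ Bv); have [] := cinvK (covG.1 c AGc) iv.
  exists (cmap d @` (cdom d `&` ~` K)); first by exists g.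
  have oO : open (cmap d @` (cdom d `&` ~` K)).
    by apply: chart_image_open; [exact: covG.1|exact: closed_openC].
  apply: (Ck_ext oO _ (Ck_cst 1 _ 0)) => _ [h [dh nKh] <-].
  by rewrite /= Kd // psiK.
- by move=> g; rewrite /psi; case: pselect => // cg; exact: sqr_ge0.
- rewrite /psi; case: pselect => // cg; rewrite /eta /sqrpos /sqdist big1 ?subr0.
    by rewrite exprn_gt0 // lt_max exprn_gt0 // orbT.
  by move=> i _; rewrite subrr mxE mul0r.
- move=> g; rewrite /psi; case: pselect => [cg /eta0 Bg|ncg]; last by rewrite eqxx.
  by have [_] := rV _ (Bball _ Bg); rewrite Kc.
Qed.

End bump.

(** * Differentiation under the Haar integral *)
Section smoothing.
Context {R : realType} {G : ptopGroupType} {n : nat}.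
Context {mG : probability (borel G) R}.
Context {AG : set (chart G 'rV[R]_n)} {c : chart G 'rV[R]_n}.
Hypotheses (G_lie : compact_lie_group AG) (mG_haar : haar mG)
  (AGc : AG c) (c1 : cdom c 1%g).

Let smG := lie_smooth G_lie.
Let covG := smooth_covering (lie_smooth G_lie).
Let covGG := prod_covering covG covG.
Let compG := compactG G_lie.

(** Otherwise [G], covered by finitely many translates of [U], would be null. *)
Lemma haar_open_nonnull (U : set G) : open U -> U 1%g -> ~ mG.-negligible U.
Proof.
move=> oU U1 [N [mN N0 UN]].
pose f (g : G) := [set h : G | U (g^-1 * h)%g].
have := compG; rewrite compact_cover => /(_ G setT f) [g _|h _|D _ covD].
- exact: ((continuousP _).1 (mulg_continuous G_lie (g := g^-1%g)) _ oU).
- by exists h => //; rewrite /f /= mulVg.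
have f0 g : mG.-negligible (f g).
  pose Ng := [set h : G | N (g^-1 * h)%g].
  have mNg : measurable (Ng : set (borel G)).
    rewrite -[X in measurable X]setTI.
    exact: (borel_continuous (mulg_continuous G_lie (g := g^-1%g))).
  exists Ng; split => //; last by move=> h; exact: UN.
  by have := mG_haar g^-1%g mN; rewrite N0.
have [M [mM M0 TM]] : mG.-negligible [set: G].
  apply: (@negligibleS _ (borel G) R mG _ _ covD); rewrite /cover bigcup_fset.
  elim/big_ind : _ => [|A B|g _]; [exact: negligible_set0|exact: negligibleU|exact: f0].
by have [h] := null_set_compl M0; apply; exact: TM.
Qed.

Lemma haar_integral_gt0 (psi : G -> R) : continuous psi -> (forall g, 0 <= psi g) ->
  0 < psi 1%g -> 0 < \int[mG]_g psi g.
Proof.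
move=> psic psi0 psi1; rewrite lt_neqAle Rintegral_ge0 // andbT.
apply/eqP => I0.
have int_psi := continuous_integrable mG compG psic.
have IE0 : (\int[mG]_(x in setT) `|(psi x)%:E|)%E = 0%E.
  transitivity (\int[mG]_(x in setT) (psi x)%:E)%E.
    by apply: eq_integral => g _; rewrite gee0_abs // lee_fin.
  by rewrite -(fineK (integrable_fin_num measurableT int_psi)) -[fine _]I0.
have mpsi : measurable_fun [set: borel G] (EFin \o psi : borel G -> \bar R).
  by apply/measurable_EFinP; exact: borel_continuous_real.
have [N [mN N0 psiN]] := (ae_eq_integral_abs mG measurableT mpsi).1 IE0.
have oU : open [set g | 0 < psi g].
  have -> : [set g | 0 < psi g] = psi @^-1` [set x | 0 < x] by [].
  by apply: ((continuousP _).1 psic); exact: open_gt.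
apply: (haar_open_nonnull oU psi1); exists N; split => // g psig.
apply: psiN => /= /(_ I) [] pg0; move: psig; rewrite /= pg0 ltxx //.
Qed.

Context {psi : G -> R^o}.
Hypothesis Cpsi : Ck_map 1 AG (flat_atlas R^o) psi.

(** The kernel of the convolution with [psi]. *)
Definition translate (p : G * G) : R^o := psi (p.1^-1 * p.2)%g.

Lemma translate_C1 : Ck_map 1 (prod_atlas AG AG) (flat_atlas R^o) translate.
Proof.
have C1 : Ck_map 1 (prod_atlas AG AG) AG (fun p => p.1^-1 * p.2)%g.
  apply: (Ck_map_mul G_lie covGG); last exact: (Ck_map_snd smG smG).
  by apply: (Ck_map_inv G_lie covGG); exact: (Ck_map_fst smG smG).
exact: (Ck_map_comp covGG covG (flat_covering R^o) C1 Cpsi).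
Qed.

Let kappa (h : G) (v : 'rV[R]_n) : R^o := translate (cinv c v, h).
Let partial i (v : 'rV[R]_n) (h : G) : R := 'D_(fvec i) (kappa h) v.
Let a := cmap c 1%g.

Lemma kappa_C1 h : Ck 1 (chart_img c) (kappa h).
Proof.
have C1 : Ck_map 1 AG (flat_atlas R^o) (fun g => translate (g, h)).
  have Cgh := Ck_map_pair covG covG covG (Ck_map_id smG 1) (Ck_map_cst (A := AG) (B := AG) 1 h).
  exact: (Ck_map_comp covG covGG (flat_covering R^o) Cgh translate_C1).
exact: (Ck_flat_chart AGc C1).
Qed.

Lemma kappa_continuous v : continuous (fun h => kappa h v).
Proof.
have [tc _] := translate_C1 => h.
exact: (cvg_comp _ _ (cvg_pair (cvg_cst (cinv c v)) cvg_id) (tc (cinv c v, h))).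
Qed.

Lemma partial_continuous i v h : chart_img c v ->
  {for (v, h), continuous (fun p => partial i p.1 p.2)}.
Proof.
move=> iv; have [d AGd dh] := covG.2 h; have dd := covG.1 d AGd.
have AGcd : prod_atlas AG AG (prod_chart c d) by exists c => //; exists d.
have CT := Ck_flat_chart AGcd translate_C1.
have [_ DT] := CT (fvec i, 0).
have [[od _] Kd cmd _] := dd.
pose T' := 'D_(fvec i, 0) (translate \o cinv (prod_chart c d)).
have T'c : {for (v, cmap d h), continuous T'}.
  apply: DT; have [x cx <-] := iv; by exists (x, h).
have E : {near (v, h), (fun p => T' (p.1, cmap d p.2)) =1 (fun p => partial i p.1 p.2)}.
  have : \forall p \near (v, h), cdom d p.2.
    have oD : nbhs h (cdom d) by exact: open_nbhs_nbhs.
    exact: (cvg_snd (F := nbhs v) (G := nbhs h) oD).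
  apply: filterS => -[w k] /= dk.
  rewrite /T' -derive_slice_l /partial; congr (lim (_ @ 0^')).
  by apply/funext => t; rewrite /= /kappa Kd.
have lim1 : (fun p => T' (p.1, cmap d p.2)) @ (v, h) --> T' (v, cmap d h).
  have pc : (fun p : 'rV[R]_n * G => (p.1, cmap d p.2)) @ (v, h) --> (v, cmap d h).
    have dc : (fun p : 'rV[R]_n * G => cmap d p.2) @ (v, h) --> cmap d h.
      by apply: (cvg_comp snd (cmap d)); [exact: cvg_snd|exact: cmd].
    exact: (cvg_pair (f := fst) cvg_fst dc).
  exact: (cvg_comp _ _ pc T'c).
have E0 : T' (v, cmap d h) = partial i v h by exact: (nbhs_singleton E).
rewrite E0 in lim1.
by apply: cvg_trans lim1; exact: near_eq_cvg E.
Qed.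

Lemma aimg : chart_img c a. Proof. by exists 1%g. Qed.

(** The partial derivatives are jointly continuous and [G] is compact. *)
Lemma partial_uniform (eps : R) : 0 < eps -> \forall v \near a,
  forall h i, `|partial i v h - partial i a h| <= eps.
Proof.
move=> eps0.
have : near_covering [set: G] by apply/compact_near_coveringP.
move=> /(_ _ (nbhs a) (fun v h => forall i, `|partial i v h - partial i a h| <= eps)).
have H : forall x : G, [set: G] x ->
    \forall x' \near x & v \near a, forall i, `|partial i v x' - partial i a x'| <= eps.
  move=> h0 _.
  have Hi i : \forall x' \near h0 & v \near a, `|partial i v x' - partial i a x'| <= eps.
    have := @partial_continuous i a h0 aimg.
    move=> /cvgrPdist_le /(_ (eps / 2)); rewrite divr_gt0 // => /(_ isT).
    case=> -[A B] /= [nA nB] AB.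
    exists (B, A) => //= -[h v] /= [Bh Av].
    have h1 := AB (v, h) (conj Av Bh); have h2 := AB (a, h) (conj (nbhs_singleton nA) Bh).
    rewrite /= in h1 h2.
    rewrite -(subrKA (partial i a h0)) [eps]splitr; apply: le_trans (ler_normD _ _) _.
    by rewrite lerD // distrC.
  exact: (@filter_forall _ _ (fun i (p : G * 'rV[R]_n) => `|partial i p.2 p.1 - partial i a p.1| <= eps) _ _ Hi).
move=> /(_ _ H); apply: filterS => v Hv h i; exact: (Hv h I i).
Qed.

(** The Taylor remainders of the integrands at [a] are uniformly small, so
    their integral is the remainder of the integral. *)
Lemma smoothed_differentiable (u : G -> R) : continuous u ->
  differentiable (fun v => \int[mG]_h (kappa h v * u h) : R^o) a.
Proof.
move=> uc; have [C uC] := compact_continuous_bounded compG uc.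
have C0 : 0 <= C by apply: le_trans (uC 1%g).
have muc (w : G -> R) : continuous w ->
    mG.-integrable setT (EFin \o (fun h => w h * u h)).
  by move=> wc; apply: continuous_integrable => // h; apply: cvgM; [exact: wc|exact: uc].
have pc i : continuous (fun h => partial i a h).
  move=> h; have pa : (fun h' : G => (a, h')) @ h --> (a, h).
    exact: (cvg_pair (cvg_cst a) cvg_id).
  exact: (cvg_comp _ _ pa (@partial_continuous i a h aimg)).
pose D i := \int[mG]_h (partial i a h * u h).
apply: (@differentiable_frechet _ _ _ _ D) => eps eps0.
(* C bounds u, so the oscillation allowed for the kernel should be eps / C; the
   added 1 takes care of C = 0 *)
pose eps' := eps / (C + 1).
have C10 : 0 < C + 1 by rewrite ltr_wpDl.
have eps'0 : 0 < eps' by rewrite divr_gt0.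
have /nbhs_ballP[r /= r0 rP] : \forall v \near a, chart_img c v /\
    forall h i, `|partial i v h - partial i a h| <= eps'.
  apply: filterI; last exact: partial_uniform.
  by apply: open_nbhs_nbhs; split; [exact: (chart_img_open (covG.1 c AGc))|exact: aimg].
apply/nbhs_ballP; exists r => //= w; rewrite -ball_normE /= sub0r normrN => wr.
pose rem h := kappa h (a + w) - kappa h a - \sum_i fco i w * partial i a h.
have remP h : `|rem h| <= eps' * \sum_i `|fco i w|.
  apply: (@C1_taylor _ _ _ (kappa h) a r) => //.
    by apply: Ck_sub (kappa_C1 h) => v /rP[].
  by move=> i y /rP[_ /(_ h i)].
have sumc : continuous (fun h => \sum_i fco i w * partial i a h).
  apply: continuous_big => [|i _ h]; first exact: add_continuous.
  by apply: cvgMl_tmp; exact: pc.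
have remc : continuous rem.
  by move=> h; apply: cvgB; [apply: cvgB; exact: kappa_continuous|exact: sumc].
have [_ sumE] := Rintegral_lincomb (index_enum 'I_(fdim 'rV[R]_n)) (fun i => fco i w)
  (fun i => muc _ (pc i)).
have -> : \int[mG]_h (kappa h (a + w) * u h) - \int[mG]_h (kappa h a * u h)
    - \sum_i fco i w * D i = \int[mG]_h (rem h * u h).
  rewrite -sumE -RintegralB //; last 2 first.
  - exact: (muc (fun h => kappa h (a + w)) (@kappa_continuous (a + w))).
  - exact: (muc (fun h => kappa h a) (@kappa_continuous a)).
  rewrite -RintegralB //; last 2 first.
  - apply: continuous_integrable => // h.
    by apply: cvgB; apply: cvgM; try exact: kappa_continuous; exact: uc.
  - apply: continuous_integrable => //.
    apply: continuous_big => [|i _ h]; first exact: add_continuous.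
    by apply: cvgMl_tmp; apply: cvgM; [exact: pc|exact: uc].
  congr Rintegral; apply/funext => h; rewrite /rem !mulrBl mulr_suml.
  by congr (_ - _); apply: eq_bigr => i _; rewrite mulrA.
apply: le_trans (le_normr_Rintegral measurableT (muc _ remc)) _.
have S0 : 0 <= \sum_i `|fco i w| by apply: sumr_ge0.
apply: (@le_trans _ _ (\int[mG]_h (eps' * (\sum_i `|fco i w|) * C))).
  apply: le_Rintegral => //.
  - apply: continuous_integrable => // h.
    by apply: cvg_norm; apply: cvgM; [exact: remc|exact: uc].
  - by apply: continuous_integrable => // h; exact: cvg_cst.
  - by move=> h _; rewrite normrM ler_pM.
rewrite Rintegral_prob_cst /eps' mulrAC ler_wpM2r //.
rewrite mulrAC ler_pdivrMr //; apply: ler_wpM2l; first exact: ltW.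
by rewrite lerDl.
Qed.

End smoothing.

(** * Differentiability of continuous representations *)
Section real_representations.
Context {R : realType} {G : ptopGroupType} {n : nat}.
Context {mG : probability (borel G) R}.
Context {AG : set (chart G 'rV[R]_n)} {c : chart G 'rV[R]_n}.
Hypotheses (G_lie : compact_lie_group AG) (mG_haar : haar mG)
  (AGc : AG c) (c1 : cdom c 1%g).
Context {p : nat} {sigma : G -> 'M[R]_p}.
Hypotheses (sigmaM : forall g h, sigma (g * h)%g = sigma g *m sigma h)
  (sigma1 : sigma 1%g = 1%:M)
  (sigmac : forall i j, continuous (fun g => sigma g i j : R)).

Let compG := compactG G_lie.

Lemma sigma_near1 (eps : R) : 0 < eps ->
  \forall g \near (1%g : G), forall ij : 'I_p * 'I_p,
    `|sigma g ij.1 ij.2 - (1%:M : 'M[R]_p) ij.1 ij.2| <= eps.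
Proof.
move=> eps0.
apply: (@filter_forall _ _ (fun (ij : 'I_p * 'I_p) (g : G) =>
  `|sigma g ij.1 ij.2 - (1%:M : 'M[R]_p) ij.1 ij.2| <= eps)) => -[i j] /=.
have := @sigmac i j 1%g; rewrite /continuous_at sigma1 => /cvgrPdist_le /(_ _ eps0).
by apply: filterS => g; rewrite distrC.
Qed.

Section smoothed.
Context {psi : G -> R^o}.
Hypotheses (Cpsi : Ck_map 1 AG (flat_atlas R^o) psi)
  (psi_ge0 : forall g, 0 <= psi g) (psi1 : 0 < psi 1%g)
  (psiV : forall g, psi g != 0 -> forall ij : 'I_p * 'I_p,
    `|sigma g ij.1 ij.2 - (1%:M : 'M[R]_p) ij.1 ij.2| <= (2 * p.+1%:R)^-1).

Let psic : continuous psi. Proof. by case: Cpsi. Qed.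

Definition average : 'M[R]_p := \matrix_(i, j) \int[mG]_h (psi h * sigma h i j).

Let psi_int (u : G -> R) : continuous u ->
  mG.-integrable setT (EFin \o (fun h => psi h * u h)).
Proof.
by move=> uc; apply: continuous_integrable => // h; apply: cvgM; [exact: psic|exact: uc].
Qed.

(** On the support of [psi], [sigma h] is close to the identity.  If
    [v *m average = 0] and [v j] is a coordinate of largest modulus, then
    [v j * (v *m sigma h) j >= (v j)^2 / 2] for all these [h]; integrating
    against [psi] forces [v j = 0]. *)
Lemma average_unit : average \in unitmx.
Proof.
rewrite -row_free_unit; apply: inj_row_free => v vA0.
have [//|v0] := eqVneq v 0; exfalso.
have [i0 vi0] : exists i, v 0 i != 0.
  apply/existsP; apply: contraR v0 => /existsPn v0.
  by apply/eqP/rowP => i; rewrite mxE; apply/eqP; have := v0 i; rewrite negbK.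
pose j := [arg max_(i > i0) `|v 0 i|]%O.
have vj i : `|v 0 i| <= `|v 0 j|.
  by rewrite /j; case: arg_maxP => // k _ /(_ i isT).
have vj0 : 0 < `|v 0 j| by apply: lt_le_trans (vj i0); rewrite normr_gt0.
pose w h := \sum_i v 0 i * sigma h i j.
have wE h : psi h != 0 -> v 0 j ^+ 2 / 2 <= v 0 j * w h.
  move=> /psiV sV.
  have E : w h = v 0 j + \sum_i v 0 i * (sigma h i j - (1%:M : 'M[R]_p) i j).
    rewrite [X in _ = _ + X](eq_bigr (fun i => v 0 i * sigma h i j - v 0 i * (1%:M : 'M[R]_p) i j)); last first.
      by move=> i _; rewrite mulrBr.
    rewrite sumrB [X in _ - X](bigD1 j) //= mxE eqxx mulr1 [X in _ - (_ + X)]big1 ?addr0.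
      by rewrite addrC subrK.
    by move=> i /negbTE ij; rewrite mxE ij mulr0.
  have B : `|\sum_i v 0 i * (sigma h i j - (1%:M : 'M[R]_p) i j)| <= `|v 0 j| / 2.
    apply: le_trans (ler_norm_sum _ _ _) _.
    apply: (@le_trans _ _ (\sum_(i < p) `|v 0 j| * (2 * p.+1%:R)^-1)).
      by apply: ler_sum => i _; rewrite normrM ler_pM //; exact: (sV (i, j)).
    rewrite sumr_const card_ord -mulrnAr ler_wpM2l // invfM -mulrnAr.
    rewrite -[leRHS]mulr1 ler_wpM2l ?invr_ge0 // -mulr_natr mulrC ler_pdivrMr // mul1r.
    by rewrite ler_nat.
  rewrite E mulrDr -expr2.
  have : `|v 0 j * \sum_i v 0 i * (sigma h i j - (1%:M : 'M[R]_p) i j)| <= v 0 j ^+ 2 / 2.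
    rewrite normrM -(real_normK (num_real (v 0 j))) expr2 -mulrA.
    by rewrite ler_wpM2l.
  by rewrite ler_norml => /andP[h1 _]; lra.
have [wint wI] := Rintegral_lincomb (index_enum 'I_p) (fun i => v 0 i)
  (fun i => psi_int (@sigmac i j)).
have w0 : \int[mG]_h (\sum_i v 0 i * (psi h * sigma h i j)) = 0.
  rewrite wI; have : (v *m average) 0 j = 0 by rewrite vA0 mxE.
  by rewrite mxE => E; rewrite -[RHS]E; apply: eq_bigr => i _; rewrite mxE.
have psi_integrable := continuous_integrable mG compG psic.
have : v 0 j ^+ 2 / 2 * \int[mG]_h psi h <= v 0 j * 0.
  rewrite -[in leRHS]w0 -!RintegralZl //.
  apply: le_Rintegral => //.
  - exact: (integrableZl measurableT _ psi_integrable).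
  - exact: (integrableZl measurableT _ wint).
  - move=> h _; have -> : \sum_i v 0 i * (psi h * sigma h i j) = psi h * w h.
      by rewrite mulr_sumr; apply: eq_bigr => i _; rewrite mulrCA.
    have [->|ph] := eqVneq (psi h) 0; first by rewrite mulr0 mul0r mulr0.
    by rewrite mulrC [leRHS]mulrCA ler_wpM2l // wE.
rewrite mulr0 leNgt => /negP; apply; rewrite mulr_gt0 //.
  by rewrite divr_gt0 // -(real_normK (num_real (v 0 j))) exprn_gt0.
exact: (haar_integral_gt0 G_lie mG_haar psic psi_ge0 psi1).
Qed.

(** The change of variables [h |-> g^-1 h] moves the dependence on [g] from
    [sigma] to the bump function, which is C^1. *)
Lemma sigma_average g :
  sigma g *m average = \matrix_(i, j) \int[mG]_h (psi (g^-1 * h)%g * sigma h i j).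
Proof.
apply/matrixP => i j; rewrite !mxE.
have uc : continuous (fun h => psi (g^-1 * h)%g * sigma h i j : R).
  move=> h; apply: cvgM; last exact: sigmac.
  by apply: (cvg_comp (fun h => g^-1 * h)%g psi); [exact: (mulg_continuous G_lie)|exact: psic].
have E := preserves_integral (mulg_continuous G_lie (g := g)) compG uc (mG_haar g).
rewrite -E.
have [_ wI] := Rintegral_lincomb (index_enum 'I_p) (fun k => sigma g i k)
  (fun k => psi_int (@sigmac k j)).
rewrite (eq_bigr (fun k => sigma g i k * \int[mG]_h (psi h * sigma h k j))); last first.
  by move=> k _; rewrite mxE.
rewrite -wI; congr Rintegral; apply/funext => h.
rewrite mulgA mulVg mul1g sigmaM mxE mulr_sumr; apply: eq_bigr => k _.
by rewrite mulrCA.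
Qed.

Lemma smoothed_sigma_differentiable i j :
  differentiable (fun v => sigma (cinv c v) i j : R^o) (cmap c 1%g).
Proof.
have -> : (fun v => sigma (cinv c v) i j : R^o) =
    \sum_k (fun v => invmx average k j *:
      (\int[mG]_h (psi ((cinv c v)^-1 * h)%g * sigma h i k) : R^o)).
  apply/funext => v; rewrite fct_sumE.
  have -> : sigma (cinv c v) = sigma (cinv c v) *m average *m invmx average.
    by rewrite mulmxK // average_unit.
  rewrite mxE sigma_average; apply: eq_bigr => k _.
  by rewrite mxE mulrC.
apply: differentiable_sum => k; apply: differentiableZ.
exact: (smoothed_differentiable G_lie AGc c1 Cpsi (@sigmac i k)).
Qed.

End smoothed.

(** Convolution with a C^1 bump function supported near the identity multiplies
    [sigma] by an invertible matrix and produces a differentiable function. *)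
Lemma real_rep_differentiable i j :
  differentiable (fun v => sigma (cinv c v) i j : R^o) (cmap c 1%g).
Proof.
have eps0 : 0 < (2 * p.+1%:R)^-1 :> R by rewrite invr_gt0 mulr_gt0.
have [psi [Cpsi psi0 psi1 psiV]] := smooth_bump G_lie AGc c1 (sigma_near1 eps0).
exact: (smoothed_sigma_differentiable Cpsi psi0 psi1 psiV).
Qed.

End real_representations.

(** * Derivatives of unitary representations *)
Section complex_derivatives.
Context {R : realType} {V : normedModType R}.
Implicit Types (f g : V -> R[i]) (d : R[i]).

Definition is_cderive (x v : V) f d : Prop :=
  is_derive x v (fun y => complex.Re (f y) : R^o) (complex.Re d) /\
  is_derive x v (fun y => complex.Im (f y) : R^o) (complex.Im d).

Lemma is_cderive_cst x v d : is_cderive x v (fun=> d) 0.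
Proof. by split; exact: is_derive_cst. Qed.

Lemma is_cderiveD x v f g d e : is_cderive x v f d -> is_cderive x v g e ->
  is_cderive x v (fun y => f y + g y) (d + e).
Proof.
move=> [f1 f2] [g1 g2]; split.
- have -> : complex.Re (d + e) = complex.Re d + complex.Re e by case: d e {f1 f2 g1 g2} => [? ?] [? ?].
  have -> : (fun y => complex.Re (f y + g y) : R^o) =
      (fun y => complex.Re (f y) : R^o) + (fun y => complex.Re (g y) : R^o).
    by apply/funext => y; rewrite -[RHS]/(_ + _); case: (f y) (g y) => [? ?] [? ?].
  exact: is_deriveD.
- have -> : complex.Im (d + e) = complex.Im d + complex.Im e by case: d e {f1 f2 g1 g2} => [? ?] [? ?].
  have -> : (fun y => complex.Im (f y + g y) : R^o) =
      (fun y => complex.Im (f y) : R^o) + (fun y => complex.Im (g y) : R^o).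
    by apply/funext => y; rewrite -[RHS]/(_ + _); case: (f y) (g y) => [? ?] [? ?].
  exact: is_deriveD.
Qed.

Lemma is_cderiveMl x v f d (a : R[i]) : is_cderive x v f d ->
  is_cderive x v (fun y => a * f y) (a * d).
Proof.
case: a => [b1 b2] [f1 f2]; split.
- have -> : complex.Re ((b1 +i* b2)%C * d) = b1 *: (complex.Re d : R^o) - b2 *: (complex.Im d : R^o).
    by case: d {f1 f2} => [? ?].
  have -> : (fun y => complex.Re ((b1 +i* b2)%C * f y) : R^o) =
      b1 *: (fun y => complex.Re (f y) : R^o) - b2 *: (fun y => complex.Im (f y) : R^o).
    by apply/funext => y; rewrite -[RHS]/(b1 * complex.Re (f y) - b2 * complex.Im (f y)); case: (f y).
  by apply: is_deriveB; apply: is_deriveZ.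
- have -> : complex.Im ((b1 +i* b2)%C * d) = b1 *: (complex.Im d : R^o) + b2 *: (complex.Re d : R^o).
    by case: d {f1 f2} => [? ?].
  have -> : (fun y => complex.Im ((b1 +i* b2)%C * f y) : R^o) =
      b1 *: (fun y => complex.Im (f y) : R^o) + b2 *: (fun y => complex.Re (f y) : R^o).
    by apply/funext => y; rewrite -[RHS]/(b1 * complex.Im (f y) + b2 * complex.Re (f y)); case: (f y).
  by apply: is_deriveD; apply: is_deriveZ.
Qed.

Lemma is_cderiveMr x v f d (a : R[i]) : is_cderive x v f d ->
  is_cderive x v (fun y => f y * a) (d * a).
Proof.
move=> /(is_cderiveMl a); rewrite mulrC.
by rewrite (_ : (fun y => a * f y) = (fun y => f y * a)) //; apply/funext => y; rewrite mulrC.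
Qed.

Lemma is_cderive_sum x v (I : Type) (s : seq I) (f : I -> V -> R[i]) (d : I -> R[i]) :
  (forall i, is_cderive x v (f i) (d i)) ->
  is_cderive x v (fun y => \sum_(i <- s) f i y) (\sum_(i <- s) d i).
Proof.
move=> fd; elim: s => [|i s IH].
  rewrite big_nil (_ : (fun y => _) = fun=> 0); first exact: is_cderive_cst.
  by apply/funext => y; rewrite big_nil.
rewrite big_cons (_ : (fun y => _) = (fun y => f i y + \sum_(j <- s) f j y)).
  exact: is_cderiveD.
by apply/funext => y; rewrite big_cons.
Qed.

Lemma is_cderive_unique x v f g d e : is_cderive x v f d -> is_cderive x v g e ->
  {near x, f =1 g} -> d = e.
Proof.
move=> [[_ f1] [_ f2]] [[_ g1] [_ g2]] fg.
have E1 : complex.Re d = complex.Re e.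
  by rewrite -f1 -g1; apply: near_eq_derive; apply: filterS fg => y ->.
have E2 : complex.Im d = complex.Im e.
  by rewrite -f2 -g2; apply: near_eq_derive; apply: filterS fg => y ->.
by case: d e E1 E2 {f1 f2 g1 g2} => [? ?] [? ?] /= -> ->.
Qed.

End complex_derivatives.

Section unitary_representations.
Context {R : realType} {G : ptopGroupType} {n m : nat}.
Context {mG : probability (borel G) R}.
Context {AG : set (chart G 'rV[R]_n)} {c : chart G 'rV[R]_n}.
Hypotheses (G_lie : compact_lie_group AG) (mG_haar : haar mG)
  (AGc : AG c) (c1 : cdom c 1%g).
Context {rho : G -> 'M[R[i]]_m}.
Hypothesis rho_rep : unitary_representation rho.

Let covG := smooth_covering (lie_smooth G_lie).

Lemma rho_1 : rho 1%g = 1%:M.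
Proof.
have [rhoU rhoM _] := rho_rep.
have := rhoM 1%g 1%g; rewrite mulg1 => E.
have /unitarymxP U := rhoU 1%g.
by rewrite -U {2}E -mulmxA U mulmx1.
Qed.

(** The matrix of [A] acting on the underlying real vector space, through which
    the results on real representations apply to [rho]. *)
Definition realify (A : 'M[R[i]]_m) : 'M[R]_(m + m) :=
  block_mx (map_mx (@complex.Re R) A) (- map_mx (@complex.Im R) A)
           (map_mx (@complex.Im R) A) (map_mx (@complex.Re R) A).

Lemma ReM (x y : R[i]) :
  complex.Re (x * y) = complex.Re x * complex.Re y - complex.Im x * complex.Im y.
Proof. by case: x y => [? ?] [? ?]. Qed.

Lemma ImM (x y : R[i]) :
  complex.Im (x * y) = complex.Re x * complex.Im y + complex.Im x * complex.Re y.
Proof. by case: x y => [? ?] [? ?]. Qed.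

Lemma Re_sum (I : Type) (s : seq I) (f : I -> R[i]) :
  complex.Re (\sum_(i <- s) f i) = \sum_(i <- s) complex.Re (f i).
Proof.
elim: s => [|i s IH]; first by rewrite !big_nil.
by rewrite !big_cons -IH; case: (f i) (\sum_(j <- s) f j) => [? ?] [? ?].
Qed.

Lemma Im_sum (I : Type) (s : seq I) (f : I -> R[i]) :
  complex.Im (\sum_(i <- s) f i) = \sum_(i <- s) complex.Im (f i).
Proof.
elim: s => [|i s IH]; first by rewrite !big_nil.
by rewrite !big_cons -IH; case: (f i) (\sum_(j <- s) f j) => [? ?] [? ?].
Qed.

Lemma realifyM A B : realify (A *m B) = realify A *m realify B.
Proof.
rewrite /realify mulmx_block !mulNmx !mulmxN.
have E1 : map_mx (@complex.Re R) (A *m B) =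
    map_mx (@complex.Re R) A *m map_mx (@complex.Re R) B -
    map_mx (@complex.Im R) A *m map_mx (@complex.Im R) B.
  apply/matrixP => i j; rewrite !mxE Re_sum -sumrB.
  by apply: eq_bigr => k _; rewrite ReM !mxE.
have E2 : map_mx (@complex.Im R) (A *m B) =
    map_mx (@complex.Re R) A *m map_mx (@complex.Im R) B +
    map_mx (@complex.Im R) A *m map_mx (@complex.Re R) B.
  apply/matrixP => i j; rewrite !mxE Im_sum -big_split.
  by apply: eq_bigr => k _; rewrite ImM !mxE.
rewrite E1 E2; congr block_mx.
- by rewrite opprD.
- by rewrite addrC.
- by rewrite addrC.
Qed.

Lemma rho_differentiable i j :
  differentiable (fun v => complex.Re (rho (cinv c v) i j) : R^o) (cmap c 1%g) /\
  differentiable (fun v => complex.Im (rho (cinv c v) i j) : R^o) (cmap c 1%g).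
Proof.
have [_ rhoM rhoc] := rho_rep.
pose sigma g := realify (rho g).
have sigmaM g h : sigma (g * h)%g = sigma g *m sigma h.
  by rewrite /sigma rhoM realifyM.
have sigma1 : sigma 1%g = 1%:M.
  rewrite /sigma rho_1 /realify scalar_mx_block; congr block_mx.
  - by apply/matrixP => k l; rewrite !mxE; case: (k == l).
  - by apply/matrixP => k l; rewrite !mxE; case: (k == l); rewrite /= oppr0.
  - by apply/matrixP => k l; rewrite !mxE; case: (k == l).
  - by apply/matrixP => k l; rewrite !mxE; case: (k == l).
have ulE k l g : sigma g (lshift m k) (lshift m l) = complex.Re (rho g k l).
  by rewrite /sigma /realify block_mxEul mxE.
have urE k l g : sigma g (lshift m k) (rshift m l) = - complex.Im (rho g k l).
  by rewrite /sigma /realify block_mxEur !mxE.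
have dlE k l g : sigma g (rshift m k) (lshift m l) = complex.Im (rho g k l).
  by rewrite /sigma /realify block_mxEdl mxE.
have drE k l g : sigma g (rshift m k) (rshift m l) = complex.Re (rho g k l).
  by rewrite /sigma /realify block_mxEdr mxE.
have sigmac k l : continuous (fun g => sigma g k l : R).
  rewrite -(splitK k) -(splitK l).
  case: (fintype.split k) => k'; case: (fintype.split l) => l' /=.
  - by rewrite (funext (ulE k' l')); exact: (rhoc k' l').1.
  - rewrite (funext (urE k' l')) => g; apply: cvgN; exact: (rhoc k' l').2.
  - by rewrite (funext (dlE k' l')); exact: (rhoc k' l').2.
  - by rewrite (funext (drE k' l')); exact: (rhoc k' l').1.
split.
- rewrite (_ : (fun v => _) = (fun v => sigma (cinv c v) (lshift m i) (lshift m j) : R^o)).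
    exact: (real_rep_differentiable G_lie mG_haar AGc c1 sigmaM sigma1 sigmac).
  by apply/funext => v; rewrite ulE.
- rewrite (_ : (fun v => _) = (fun v => sigma (cinv c v) (rshift m i) (lshift m j) : R^o)).
    exact: (real_rep_differentiable G_lie mG_haar AGc c1 sigmaM sigma1 sigmac).
  by apply/funext => v; rewrite dlE.
Qed.

Lemma drep_is_cderive Z i j :
  is_cderive (cmap c 1%g) Z (fun v => rho (cinv c v) i j) (drep c rho Z i j).
Proof.
have [d1 d2] := rho_differentiable i j.
split; rewrite mxE /=; apply: derivableP; exact: diff_derivable.
Qed.

(** Chain rule for [rho] along [h |-> g h g^-1], whose differential at the
    identity is [Ad_g]. *)
Lemma drep_inner g Z i j :
  is_cderive (cmap c 1%g) Z (fun v => rho (g * cinv c v * g^-1)%g i j)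
    (drep c rho (Ad c g Z) i j).
Proof.
pose ad := cmap c \o (fun h => g * h * g^-1)%g \o cinv c.
have [[oc oi] Kc _ _] := covG.1 c AGc.
have c1' : cdom c (g * 1 * g^-1)%g by rewrite inner1.
pose proof (dad := chart_differentiable covG covG AGc AGc c1 c1' (inner_Ck G_lie 1 g)).
have ad1 : ad (cmap c 1%g) = cmap c 1%g by rewrite /ad /= Kc // inner1.
have near_ad : \forall v \near cmap c 1%g, cinv c (ad v) = (g * cinv c v * g^-1)%g.
  have oO : open (cmap c @` (cdom c `&` (fun h => g * h * g^-1)%g @^-1` cdom c)).
    by apply: (Ck_map_dom_open covG covG AGc AGc); case: (inner_Ck G_lie 0 g).
  near=> v.
  have [h [ch dh] <-] : (cmap c @` (cdom c `&` (fun h => g * h * g^-1)%g @^-1` cdom c)) v.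
    by near: v; apply: open_nbhs_nbhs; split => //; exists 1%g => //; split => //=.
  by rewrite /ad /= Kc // Kc.
have key (f : 'rV[R]_n -> R^o) (f' : G -> R^o) :
    f = f' \o cinv c -> differentiable f (cmap c 1%g) ->
    is_derive (cmap c 1%g) Z (fun v => f' (g * cinv c v * g^-1)%g)
      ('D_(Ad c g Z) f (cmap c 1%g)).
  move=> fE df; have df' : differentiable f (ad (cmap c 1%g)) by rewrite ad1.
  apply: (@near_eq_is_derive _ _ _ (f \o ad)).
    by apply: filterS near_ad => v E; rewrite fE /= E.
  apply: DeriveDef; first exact/diff_derivable/differentiable_comp.
  by rewrite -[X in _ = 'D_ _ f X]ad1; exact: (derive_comp Z dad df').
have [d1 d2] := rho_differentiable i j.
split; rewrite mxE /=.
- exact: (key _ (fun h => complex.Re (rho h i j) : R^o) erefl d1).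
- exact: (key _ (fun h => complex.Im (rho h i j) : R^o) erefl d2).
Unshelve. all: by end_near. Qed.

(** Differentiate [rho g *m rho h = rho (g h g^-1) *m rho g] at [h = 1] in the
    direction [Z]. *)
Lemma drep_comm Z : Ad_fixed c Z -> forall g,
  rho g *m drep c rho Z = drep c rho Z *m rho g.
Proof.
move=> fixZ g; have [_ rhoM _] := rho_rep.
apply/matrixP => i j; rewrite !mxE.
have L : is_cderive (cmap c 1%g) Z (fun v => \sum_k rho g i k * rho (cinv c v) k j)
    (\sum_k rho g i k * drep c rho Z k j).
  by apply: is_cderive_sum => k; apply: is_cderiveMl; exact: drep_is_cderive.
have L' : is_cderive (cmap c 1%g) Z
    (fun v => \sum_k rho (g * cinv c v * g^-1)%g i k * rho g k j)
    (\sum_k drep c rho Z i k * rho g k j).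
  apply: is_cderive_sum => k; apply: is_cderiveMr.
  by rewrite -{2}(fixZ g); exact: drep_inner.
apply: (is_cderive_unique L L'); near=> v.
have := congr1 (fun A : 'M[R[i]]_m => A i j) (rhoM (g * cinv c v * g^-1)%g g).
rewrite -mulgA mulVg mulg1 rhoM !mxE => ->.
by [].
Unshelve. all: by end_near. Qed.

Lemma drep_mem Z : mx_lie_algebra (range rho) (drep c rho Z).
Proof.
have [[oc oi] Kc _ _] := covG.1 c AGc.
exists (fun t => rho (cinv c (cmap c 1%g + t *: Z))); split.
- by rewrite scale0r addr0 Kc // rho_1.
- by near=> t; exists (cinv c (cmap c 1%g + t *: Z)).
move=> i j; have [d1 d2] := rho_differentiable i j.
have key (f : 'rV[R]_n -> R^o) : differentiable f (cmap c 1%g) ->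
    is_derive (0 : R) (1 : R) (fun t => f (cmap c 1%g + t *: Z)) ('D_Z f (cmap c 1%g)).
  move=> df; rewrite -{2}[cmap c 1%g]addr0 -(scale0r Z).
  by apply: is_derive_line; rewrite scale0r addr0; exact: diff_derivable.
by split; rewrite mxE /=; [exact: (key _ d1)|exact: (key _ d2)].
Unshelve. all: by end_near. Qed.

(** A curve in the image of [rho] commutes with [drep c rho Z] at all times
    near 0, hence so does its velocity. *)
Lemma drep_center Z : Ad_fixed c Z ->
  lie_center mx_bracket (mx_lie_algebra (range rho)) (drep c rho Z).
Proof.
move=> fixZ; split; first exact: drep_mem.
move=> W [y [y0 yrho yW]]; apply/eqP; rewrite subr_eq0; apply/eqP.
set D := drep c rho Z.
apply/matrixP => i j; rewrite !mxE.
have yd k l : is_cderive (0 : R^o) (1 : R^o) (fun t => y t k l) (W k l) by exact: yW.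
have L : is_cderive (0 : R^o) (1 : R^o) (fun t => \sum_k y t i k * D k j) (\sum_k W i k * D k j).
  by apply: is_cderive_sum => k; apply: is_cderiveMr.
have L' : is_cderive (0 : R^o) (1 : R^o) (fun t => \sum_k D i k * y t k j) (\sum_k D i k * W k j).
  by apply: is_cderive_sum => k; apply: is_cderiveMl.
apply: (is_cderive_unique L L'); apply: filterS yrho => t [g _ yt].
have := congr1 (fun A : 'M[R[i]]_m => A i j) (drep_comm fixZ g).
by rewrite yt !mxE.
Qed.

End unitary_representations.

(** * Semisimple Lie algebras *)
Section semisimple.
Context {R : realType} {G : ptopGroupType} {n : nat}.
Context {AG : set (chart G 'rV[R]_n)} {c : chart G 'rV[R]_n}.
Hypotheses (G_lie : compact_lie_group AG) (AGc : AG c) (c1 : cdom c 1%g).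

(** The line spanned by [Z] is an ideal on which all brackets vanish. *)
Lemma semisimple_Ad_fixed Z : lie_semisimple (bracket c) -> Ad_fixed c Z -> Z = 0.
Proof.
move=> ss fixZ.
have br0 W Y : Y \in <[Z]>%VS -> bracket c W Y = 0.
  move=> /vlineP[k ->].
  by apply: bracket_fixed; exact: (Ad_fixed_scalar G_lie AGc c1).
have : <[Z]>%VS = 0%VS.
  apply: ss; first by move=> W Y /(br0 W) ->; exact: mem0v.
  exists 1%N; apply/eqP; rewrite -subv0; apply/span_subvP => Y /=.
  move=> /allpairsP[[U V] [_ VZ ->]] /=.
  by rewrite br0 ?mem0v //; exact: vbasis_mem.
by move=> /eqP; rewrite -dimv_eq0 dim_vline eqb0 negbK => /eqP.
Qed.

End semisimple.

(** * The degree of a uniquely ergodic skew product *)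

Theorem mainTheorem13 (R : realType)
    (X : ptopologicalType) (dX : nat) (AX : set (chart X 'rV[R]_dX))
    (mX : probability (borel X) R) (F : R -> X -> X)
    (G : ptopGroupType) (dG : nat) (AG : set (chart G 'rV[R]_dG))
    (mG : probability (borel G) R)
    (c : chart G 'rV[R]_dG) (ip : {dot 'rV[R]_dG for idfun})
    (X_manifold : compact_manifold AX)
    (F_flow : C1_flow AX F)
    (F_preserves : forall t, preserves mX (F t))
    (G_lie : compact_lie_group AG)
    (mG_haar : haar mG)
    (c_chart : AG c) (c_at1 : cdom c 1%g)
    (ip_inv : Ad_invariant c ip) :
  (connected [set: G] ->
   forall phi : X -> G, Ck_map 1 AX AG phi ->
   uniquely_ergodic ((mX \x mG)%E : set (X * G) -> \bar R) (skew_product F phi) ->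
   let Mstar := M_star F c phi mX mG in
   [/\ Ad_fixed c = lie_center (bracket c) [set: 'rV[R]_dG],
       is_degree F c phi mX ip (fun=> Mstar),
       forall p, is_degree F c phi mX ip p -> {ae mX, forall x, p x = Mstar},
       lie_center (bracket c) [set: 'rV[R]_dG] Mstar &
       forall (m : nat) (rho : G -> 'M[R[i]]_m),
         unitary_representation rho -> irreducible_representation rho ->
         set_surj [set: 'rV[R]_dG] (mx_lie_algebra (range rho)) (drep c rho) ->
         lie_center mx_bracket (mx_lie_algebra (range rho))
           (drep c rho Mstar)]) /\
  (connected [set: G] -> lie_semisimple (bracket c) ->
   ~ exists (phi : X -> G) (p : X -> 'rV[R]_dG),
     [/\ Ck_map 1 AX AG phi,
         uniquely_ergodic ((mX \x mG)%E : set (X * G) -> \bar R) (skew_product F phi),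
         is_degree F c phi mX ip p &
         (0 < mX [set x | (p x != 0)%R])%E]).
Proof.
have fixed phi : Ad_fixed c (M_star F c phi mX mG).
  exact: (Mstar_fixed G_lie mG_haar c_chart c_at1).
split=> [conG phi C1phi ue Mstar|conG ss [phi [p [C1phi ue degp pos]]]].
  have center := Ad_fixed_center G_lie c_chart c_at1 conG.
  split=> //.
  - exact: (degree_Mstar X_manifold F_flow G_lie mG_haar c_chart c_at1 ip_inv C1phi ue).
  - exact: (degree_unique X_manifold F_flow G_lie mG_haar c_chart c_at1 ip_inv C1phi ue).
  - by rewrite -center; exact: fixed.
  - move=> m rho rho_rep _ _.
    exact: (drep_center G_lie mG_haar c_chart c_at1 rho_rep (fixed phi)).
have := degree_unique X_manifold F_flow G_lie mG_haar c_chart c_at1 ip_inv C1phi ue degp.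
rewrite (semisimple_Ad_fixed G_lie c_chart c_at1 ss (fixed phi)) => p0.
have mp : measurable ([set x | (p x != 0)%R] : set (borel X)).
  have [_ [[mp _] _] _] := degp.
  rewrite -[X in measurable X]setTI.
  have -> : [set x | (p x != 0)%R] = (p : borel X -> borel 'rV[R]_dG) @^-1` ~` [set 0].
    by apply/seteqP; split=> x /= /eqP.
  apply: mp => //; apply: borel_open; apply: closed_openC.
  by apply: accessible_closed_set1; apply: hausdorff_accessible; exact: norm_hausdorff.
have negl : mX.-negligible [set x | (p x != 0)%R].
  by apply: (negligibleS _ p0) => x px px0; move: px; rewrite /= px0 eqxx.
have E : mX [set x | (p x != 0)%R] = 0%E by exact: (measure_negligible mp negl).
by move: pos; rewrite E ltxx.
Qed.
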